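(* Let $\lambda,\mu$ be partitions with lengths $r_1,r_2$ and associated sequences $(n_i)_{i=1}^{r_1}$, $(m_j)_{j=1}^{r_2}$, set $r=r_1+r_2$, and let $\alpha,\beta\in\mathbb{R}$ be such that $$\alpha+\beta+n_i\notin\{-1,\dots,-n_i\}\ (1\le i\le r_1),\qquad \alpha-\beta+m_j\notin\{-1,\dots,-m_j\}\ (1\le j\le r_2),$$ $$\beta\ne m_j-n_i\ (1\le i\le r_1,\ 1\le j\le r_2).$$ Assume that $\alpha+r>-1$ and $\beta+r>-1$. Let $z_*\in\mathbb{C}\setminus[-1,1]$ be a simple zero of $\Omega^{(\alpha,\beta)}_{\lambda,\mu}$. For $n\in\mathbb{N}_{\lambda,\mu}$ let $z^{(\alpha,\beta)}_{1,n},\dots,z^{(\alpha,\beta)}_{n-N(n),n}$ denote the exceptional zeros of $P^{(\alpha,\beta)}_{\lambda,\mu,n}$, i.e. its zeros in $\mathbb{C}\setminus(-1,1)$ listed with multiplicity. Then there is a constant $c>0$ such that for all sufficiently large $n\in\mathbb{N}_{\lambda,\mu}$ $$\min_{k=1,\dots,n-N(n)}\big|z_*-z^{(\alpha,\beta)}_{k,n}\big|<\frac{c}{n}.$$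
   Context: Jacobi polynomials: for $\alpha,\beta\in\mathbb{R}$ and an integer $n\ge 0$, $P_n^{(\alpha,\beta)}(x)=2^{-n}\sum_{j=0}^n\binom{n+\alpha}{j}\binom{n+\beta}{n-j}(x-1)^{n-j}(x+1)^j$ (generalized binomial coefficients). A set $\{-1,-2,\dots,-k\}$ is empty when $k=0$. Wronskian: $\mathrm{Wr}[g_1,\dots,g_k]=\det\big(\tfrac{d^{i-1}}{dx^{i-1}}g_j\big)_{1\le i,j\le k}$, equal to $1$ when $k=0$. Partitions: a partition $\lambda$ is a weakly decreasing finite (possibly empty) sequence of positive integers $\lambda_1\ge\dots\ge\lambda_{r_1}$; $r_1$ is its length, $|\lambda|=\sum_i\lambda_i$, and its associated strictly decreasing sequence is $n_i=\lambda_i+r_1-i$, $1\le i\le r_1$. Likewise $\mu$ has length $r_2$ and associated sequence $m_j=\mu_j+r_2-j$, $1\le j\le r_2$. Degree sequence: $\mathbb{N}_{\lambda,\mu}=\{n\in\mathbb{Z}_{\ge0}: n\ge|\lambda|+|\mu|-r_1\text{ and }n-|\lambda|-|\mu|\ne\lambda_j-j\text{ for }j=1,\dots,r_1\}$. Generalized and exceptional Jacobi polynomials: put $f_j(x)=P^{(\alpha,\beta)}_{n_j}(x)$ for $1\le j\le r_1$ and $f_{r_1+j}(x)=(1+x)^{-\beta}P^{(\alpha,-\beta)}_{m_j}(x)$ for $1\le j\le r_2$. Then $$\Omega^{(\alpha,\beta)}_{\lambda,\mu}(x)=(1+x)^{(\beta+r_1)r_2}\,\mathrm{Wr}[f_1,\dots,f_r],$$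 and for $n\in\mathbb{N}_{\lambda,\mu}$, with $s=n-|\lambda|-|\mu|+r_1$, $$P^{(\alpha,\beta)}_{\lambda,\mu,n}(x)=(1+x)^{(\beta+r_1+1)r_2}\,\mathrm{Wr}[f_1,\dots,f_r,P_s^{(\alpha,\beta)}].$$ Both are polynomials in $x$ (computed on $x>-1$ and extended to $\mathbb{C}$); under the hypotheses of the claim $P^{(\alpha,\beta)}_{\lambda,\mu,n}$ has degree $n$ for all sufficiently large $n\in\mathbb{N}_{\lambda,\mu}$. $N(n)$ denotes the number of zeros of $P^{(\alpha,\beta)}_{\lambda,\mu,n}$ in $(-1,1)$, counted with multiplicity. *)

(* Defs.v *)
From HB Require Import structures.
From mathcomp Require Import all_boot all_order all_algebra.
From mathcomp Require Import complex.
From mathcomp Require Import all_classical all_reals all_analysis.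

Set Implicit Arguments.
Unset Strict Implicit.
Unset Printing Implicit Defensive.

Import Order.TTheory GRing.Theory Num.Theory.
Import numFieldNormedType.Exports.

Local Open Scope ring_scope.
Local Open Scope complex_scope.

(* Partitions are 0-indexed lists: the part lambda_(i+1) is [nth 0 lam i]. *)
Definition is_intpart (lam : seq nat) : bool :=
  sorted geq lam && (0%N \notin lam).

(* No truncation occurs in [size lam - i.+1], since i < size lam. *)
Definition assoc_seq (lam : seq nat) : seq nat :=
  mkseq (fun i => nth 0%N lam i + (size lam - i.+1))%N (size lam).

Definition degree_seq (lam mu : seq nat) (n : nat) : Prop :=
  (sumn lam)%:Z + (sumn mu)%:Z - (size lam)%:Z <= n%:Z /\
  forall j : nat, (j < size lam)%N ->
    n%:Z - (sumn lam)%:Z - (sumn mu)%:Z != (nth 0%N lam j)%:Z - j.+1%:Z.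

Definition gbinom (R : realType) (a : R) (k : nat) : R :=
  (\prod_(i < k) (a - i%:R)) / k`!%:R.

Definition jacobi (R : realType) (a b : R) (n : nat) : {poly R} :=
  (2 ^- n) *: \sum_(j < n.+1)
    (gbinom (n%:R + a) j * gbinom (n%:R + b) (n - j)) *:
    (('X - 1) ^+ (n - j) * ('X + 1) ^+ j).

Definition wronskian (R : realType) (g : seq (R -> R)) (x : R) : R :=
  \det (\matrix_(i < size g, j < size g) ((nth (fun=> 0) g j)^`(i))%classic x).

Definition jacobi_family (R : realType) (a b : R) (lam mu : seq nat) :
    seq (R -> R) :=
  [seq (fun x => (jacobi a b n).[x]) | n <- assoc_seq lam] ++
  [seq (fun x => (1 + x) `^ (- b) * (jacobi a (- b) m).[x])
     | m <- assoc_seq mu].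

(* The polynomial that agrees with f on ]-1, +oo[; it is unique if it exists
   (the value 0 is used otherwise). *)
Definition poly_extending (R : realType) (f : R -> R) : {poly R} :=
  xget 0 [set p : {poly R} | forall x : R, -1 < x -> p.[x] = f x]%classic.

(* For [gen_jacobi] and [exc_jacobi] the polynomial always exists: by
   multilinearity the Wronskian is a combination of Wronskians of powers of
   1 + x with exponents a_1, ..., a_p and b_1 - beta, ..., b_q - beta, where the
   a_i, and likewise the b_j, are distinct natural numbers; each is a constant
   times (1 + x)^(sum a_i + sum b_j - q beta - (p + q) (p + q - 1) / 2), and
   (1 + x)^((beta + p) q) makes the exponent a natural number. *)
Definition gen_jacobi (R : realType) (a b : R) (lam mu : seq nat) : {poly R} :=
  poly_extending (fun x : R =>
    (1 + x) `^ ((b + (size lam)%:R) * (size mu)%:R) *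
    wronskian (jacobi_family a b lam mu) x).

(* The subtraction is not truncated when [degree_seq lam mu n] holds. *)
Definition exc_jacobi (R : realType) (a b : R) (lam mu : seq nat) (n : nat) :
    {poly R} :=
  let s := (n + size lam - (sumn lam + sumn mu))%N in
  poly_extending (fun x : R =>
    (1 + x) `^ ((b + (size lam)%:R + 1) * (size mu)%:R) *
    wronskian (rcons (jacobi_family a b lam mu)
                     (fun y => (jacobi a b s).[y])) x).

Definition cpoly (R : realType) (p : {poly R}) : {poly R[i]} :=
  map_poly (real_complex R) p.

(* The complex zeros listed with multiplicity, for p != 0. *)
Definition czeros (R : realType) (p : {poly R}) : seq R[i] :=
  sval (closed_field_poly_normal (cpoly p)).

(* In R[i], x <= y means that x and y have the same imaginary part and that
   their real parts are ordered, so `]-1, 1[ is the real interval in C. *)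
Definition exc_zeros (R : realType) (a b : R) (lam mu : seq nat) (n : nat) :
    seq R[i] :=
  [seq z <- czeros (exc_jacobi a b lam mu n) | z \notin `]-1, 1[].

(* Main.v *)
Require Import Defs.
From HB Require Import structures.
From mathcomp Require Import all_boot all_order all_algebra.
From mathcomp Require Import perm complex.
From mathcomp Require Import all_classical all_reals all_analysis.
From mathcomp Require Import ring lra zify.

Set Implicit Arguments.
Unset Strict Implicit.
Unset Printing Implicit Defensive.

Import Order.TTheory GRing.Theory Num.Theory.
Import numFieldNormedType.Exports.
Import ComplexField.Normc.

Local Open Scope ring_scope.
Local Open Scope complex_scope.

(** Expanding the Wronskian along its last column writes [(1 + x)^K P_n], with
    [P_n] the exceptional polynomial, as
    [(1 + x)^m Omega P_s^(r) + sum_(i < r) W_i P_s^(i)], where [P_s] is the Jacobi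
    polynomial and the polynomials [W_i] do not depend on [n]. Up to a constant,
    [P_s^(r)] is a Jacobi polynomial with parameters [alpha + r, beta + r > -1], so
    its zeros lie in [-1, 1]; hence [P_s^(r+1) = O(s) P_s^(r)] away from [-1, 1],
    and the Jacobi equation, read from high to low derivatives, gives
    [P_s^(i) = O(1/s) P_s^(r)] for [i < r]. Near [z_*] the quotient
    [(1 + x)^K P_n / P_s^(r)] is therefore [(1 + x)^m Omega + O(1/s)]: it is
    [O(1/s)] at [z_*] and, the zero of [Omega] being simple, larger than that on
    the circle of radius [c/s] once [c] is large. By the minimum modulus principle
    it vanishes inside this circle. *)

(** * Minimum modulus principle for quotients of polynomials *)

Lemma prodr_const_seq (A : pzSemiRingType) (I : Type) (s : seq I) (x : A) :
  \prod_(i <- s) x = x ^+ size s.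
Proof. by elim: s => [|i s IHs]; rewrite ?big_nil // big_cons IHs exprS. Qed.

Section MinimumModulus.
Context {R : realType}.
Local Notation C := R[i].
Implicit Types (z w d : C) (p q : {poly C}) (rho t e A : R).

Lemma normc_ge0 z : 0 <= normc z.
Proof. by case: z => x y; rewrite sqrtr_ge0. Qed.

Lemma normcX z n : normc (z ^+ n) = normc z ^+ n.
Proof. by elim: n => [|n IHn]; rewrite ?normc1 // !exprS normcM IHn. Qed.

Lemma normc_prod (I : Type) (s : seq I) (F : I -> C) :
  normc (\prod_(i <- s) F i) = \prod_(i <- s) normc (F i).
Proof. exact: (big_morph _ (@normcM R) (normc1 R)). Qed.

Lemma normc_real t : normc t%:C = `|t|.
Proof. by rewrite /= expr0n addr0 sqrtr_sqr. Qed.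

Lemma normc_dist z w : normc (z - w) = normc (w - z).
Proof. by rewrite -normcN opprB. Qed.

Lemma normc_eq0 z : (normc z == 0) = (z == 0).
Proof.
by apply/eqP/eqP => [/eq0_normc //|->]; rewrite normc0.
Qed.

Lemma normc_gt0 z : (0 < normc z) = (z != 0).
Proof. by rewrite lt_def normc_ge0 andbT normc_eq0. Qed.

Lemma le_normc_sub z w : normc z - normc w <= normc (z - w).
Proof. by rewrite lerBlDr -{1}(subrK w z) le_normcD. Qed.

Lemma expr_small t e : 0 <= t < 1 -> 0 < e ->
  exists N0, forall N, (N0 <= N)%N -> t ^+ N < e.
Proof.
move=> /andP[t0 t1] e0.
have /cvgr0Pnorm_lt/(_ e e0)[N0 _ HN0] :
    (t ^+ n @[n --> \oo] --> (0 : R))%classic.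
  by apply: cvg_expr; rewrite ger0_norm.
by exists N0 => N /HN0 /=; rewrite ger0_norm ?exprn_ge0.
Qed.

(** The roots come from splitting ['X^N - 1]. The product is the homogenised factorisation: evaluate
    at [d / w] when [w != 0], and count the factors when [w = 0]. *)
Lemma unity_roots_exist N : (0 < N)%N ->
  exists ws : seq C, [/\ size ws = N, forall w, w \in ws -> w ^+ N = 1
    & forall d w, \prod_(u <- ws) (d - w * u) = d ^+ N - w ^+ N].
Proof.
move=> N0; have monN : ('X^N - 1%:P : {poly C}) \is monic by rewrite monicXnsubC.
have [ws] := closed_field_poly_normal ('X^N - 1%:P : {poly C}).
rewrite (monicP monN) scale1r => Ews.
have szws : size ws = N.
  by apply: succn_inj; rewrite -(size_prod_XsubC ws id) -Ews size_XnsubC.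
exists ws; split=> // [w w_ws|d w].
  apply/eqP; rewrite -subr_eq0; suff: root ('X^N - 1%:P) w.
    by rewrite /root !hornerE.
  by rewrite Ews root_prod_XsubC.
have [->|w0] := eqVneq w 0.
  rewrite expr0n eqn0Ngt N0 subr0 -szws -prodr_const_seq.
  by apply: eq_bigr => u _; rewrite mul0r subr0.
have -> : \prod_(u <- ws) (d - w * u) = \prod_(u <- ws) (w * (d / w - u)).
  by apply: eq_bigr => u _; rewrite mulrBr mulrCA divff ?mulr1.
rewrite big_split /= prodr_const_seq szws.
have := congr1 (fun p => p.[d / w]) Ews.
rewrite horner_prod !hornerE => Ed.
under eq_bigr => u _ do rewrite -(hornerXsubC u (d / w)).
by rewrite -Ed expr_div_n mulrBr mulr1 mulrCA divff ?mulr1 ?expf_neq0.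
Qed.

(** Exchanging the two products leaves, for each root [z], the product of [z - z0 - rho u] over the
    roots of unity [u], which collapses to a difference of [N]-th powers. *)
Lemma prod_unity_horner N (ws : seq C) z0 rho (rs : seq C) (c : C) :
  (forall d w, \prod_(u <- ws) (d - w * u) = d ^+ N - w ^+ N) ->
  size ws = N ->
  \prod_(u <- ws) normc (c *: \prod_(z <- rs) ('X - z%:P)).[z0 + rho%:C * u]
    = normc c ^+ N * \prod_(z <- rs) normc ((z - z0) ^+ N - rho%:C ^+ N).
Proof.
move=> Hws szws.
under eq_bigr => u _ do rewrite hornerZ normcM horner_prod normc_prod.
rewrite big_split /= prodr_const_seq szws; congr (_ * _).
rewrite exchange_big /=; apply: eq_bigr => z _.
rewrite -Hws normc_prod; apply: eq_bigr => u _.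
by rewrite hornerXsubC -normcN; congr normc; ring.
Qed.
(** Since [rho / |z - z0| < 1], its [N]-th power is eventually below [1/2], so each factor lies
    within a factor 2 of [|z - z0| ^ N]. The constant [2 ^+ size rs] does not depend on [N], so it
    is harmless under [N]-th roots. *)
Lemma prod_normc_subX_bounds z0 rho (rs : seq C) : 0 < rho ->
  (forall z, z \in rs -> rho < normc (z - z0)) ->
  exists N0, forall N, (N0 <= N)%N ->
    let M := \prod_(z <- rs) normc (z - z0) in
    M ^+ N <= 2 ^+ size rs *
                \prod_(z <- rs) normc ((z - z0) ^+ N - rho%:C ^+ N) /\
    \prod_(z <- rs) normc ((z - z0) ^+ N - rho%:C ^+ N)
      <= 2 ^+ size rs * M ^+ N.
Proof.
move=> rho0; elim: rs => [|z rs IHrs] rs_far.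
  by exists 0%N => N _; rewrite /= !big_nil expr1n !expr0 !mul1r; split.
have [|N1 HN1] := IHrs; first by move=> w w_rs; apply: rs_far; rewrite inE w_rs orbT.
have zfar : rho < normc (z - z0) by apply: rs_far; rewrite mem_head.
have d0 : 0 < normc (z - z0) by apply: lt_trans zfar.
have [||N2 HN2] := @expr_small (rho / normc (z - z0)) 2^-1.
- by rewrite divr_ge0 ?ltW //= ltr_pdivrMr // mul1r.
- by rewrite invr_gt0.
exists (maxn N1 N2) => N; rewrite geq_max => /andP[/HN1 [lo up] /HN2].
rewrite expr_div_n ltr_pdivrMr ?exprn_gt0 // => small.
rewrite /= !big_cons exprMn exprS.
set P := \prod_(j <- rs) normc (_ - _ ^+ N) in lo up *.
set M := \prod_(j <- rs) normc (j - z0) in lo up *.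
have P0 : 0 <= P by apply: prodr_ge0 => i _; apply: normc_ge0.
have M0 : 0 <= M ^+ N by apply/exprn_ge0/prodr_ge0 => i _; apply: normc_ge0.
have E : normc (rho%:C ^+ N) = rho ^+ N by rewrite normcX normc_real gtr0_norm.
have := le_normc_sub ((z - z0) ^+ N) (rho%:C ^+ N).
have := le_normcD ((z - z0) ^+ N) (- rho%:C ^+ N).
rewrite normcN E normcX; set d := normc _ ^+ N in small *.
set e := normc _ => le1 le2.
have d0' : 0 < d by rewrite exprn_gt0.
have e0 : 0 <= e by apply: normc_ge0.
by split; rewrite mulrACA; apply: ler_pM => //; lra.
Qed.

(* The geometric mean of [normc p] over the points [z0 + rho u], [u ^+ N = 1],
   is a product of terms [normc (d ^+ N - rho ^+ N)] over the shifted roots [d]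
   of [p], hence tends to [normc p.[z0]] when all of them exceed [rho]; this
   replaces the maximum principle. *)
Lemma minimum_modulus p q z0 rho A : 0 < rho -> 0 < A ->
  (forall z, root p z -> rho < normc (z - z0)) ->
  (forall z, root q z -> rho < normc (z - z0)) ->
  (forall z, normc (z - z0) = rho -> A * normc p.[z] <= normc q.[z]) ->
  A * normc p.[z0] <= normc q.[z0].
Proof.
move=> rho0 A0 p_far q_far Apq.
have root_far (r : {poly C}) : (forall z, root r z -> rho < normc (z - z0)) ->
    r.[z0] != 0.
  by move=> r_far; apply/negP => /r_far; rewrite subrr normc0 ltNge ltW.
have p0 := root_far _ p_far; have q0 := root_far _ q_far.
have [rp Ep] := closed_field_poly_normal p.
have [rq Eq] := closed_field_poly_normal q.
have lead0 (r : {poly C}) : r.[z0] != 0 -> lead_coef r != 0.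
  by rewrite lead_coef_eq0; apply: contraNneq => ->; rewrite horner0.
have [||Np HNp] := @prod_normc_subX_bounds z0 rho rp.
- exact: rho0.
- by move=> z z_rp; apply: p_far; rewrite Ep rootZ ?lead0 // root_prod_XsubC.
have [||Nq HNq] := @prod_normc_subX_bounds z0 rho rq.
- exact: rho0.
- by move=> z z_rq; apply: q_far; rewrite Eq rootZ ?lead0 // root_prod_XsubC.
rewrite leNgt; apply/negP => lt_qp.
have ap0 : 0 < A * normc p.[z0] by rewrite mulr_gt0 ?normc_gt0.
(* If [|q(z0)| < A |p(z0)|], the [N]-th power of the ratio drops below [K^-1] for large [N].
   Multiplying the hypothesis over the [N] points of the circle keeps it at least [K^-1], where [K]
   collects the constants from the roots of [p] and of [q]. *)
pose K : R := 2 ^+ size rp * 2 ^+ size rq.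
have K0 : 0 < K by rewrite mulr_gt0 ?exprn_gt0.
have [||N3 HN3] := @expr_small (normc q.[z0] / (A * normc p.[z0])) (K^-1).
- by rewrite divr_ge0 ?normc_ge0 ?ltW //= ltr_pdivrMr ?mul1r.
- by rewrite invr_gt0.
pose N := (maxn 1 (maxn Np (maxn Nq N3))).
have N0 : (0 < N)%N by rewrite /N leq_max.
have [ws [szws ws1 Hws]] := @unity_roots_exist N N0.
have := HN3 N; rewrite /N !leq_max leqnn !orbT => /(_ isT); rewrite -/N.
rewrite expr_div_n ltr_pdivrMr ?exprn_gt0 // [ltRHS]mulrC ltr_pdivlMr //.
apply/negP; rewrite -leNgt.
have := HNp N; rewrite /N !leq_max leqnn !orbT => /(_ isT) [lop _].
have := HNq N; rewrite /N !leq_max leqnn !orbT => /(_ isT) [_ upq].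
rewrite -/N in lop upq.
have Mp := @prod_unity_horner N ws z0 rho rp (lead_coef p) Hws szws.
have Mq := @prod_unity_horner N ws z0 rho rq (lead_coef q) Hws szws.
rewrite -Ep in Mp; rewrite -Eq in Mq.
have MM : A ^+ N * \prod_(u <- ws) normc p.[z0 + rho%:C * u] <=
          \prod_(u <- ws) normc q.[z0 + rho%:C * u].
  rewrite -{1}szws -prodr_const_seq -big_split /= big_seq [leRHS]big_seq.
  apply: ler_prod => u u_ws; apply/andP; split.
    by rewrite mulr_ge0 ?normc_ge0 ?(ltW A0).
  apply: Apq; rewrite addrC addKr normcM normc_real gtr0_norm //.
  have : normc u ^+ N = 1 by rewrite -normcX ws1 ?normc1.
  by move/eqP; rewrite pexpr_eq1 ?normc_ge0 // => /eqP->; rewrite mulr1.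
have at0 (c : C) (rs : seq C) : normc (c *: \prod_(z <- rs) ('X - z%:P)).[z0]
    = normc c * \prod_(z <- rs) normc (z - z0).
  rewrite hornerZ normcM horner_prod normc_prod; congr (_ * _).
  by apply: eq_bigr => z _; rewrite hornerXsubC normc_dist.
rewrite Ep Eq !at0.
rewrite Mp Mq in MM.
have cp0 : 0 <= (A * normc (lead_coef p)) ^+ N.
  by rewrite exprn_ge0 // mulr_ge0 ?normc_ge0 ?ltW.
have cq0 : 0 <= normc (lead_coef q) ^+ N * 2 ^+ size rp.
  by rewrite mulr_ge0 ?exprn_ge0 ?normc_ge0.
have two0 : 0 < 2 ^+ size rp :> R by rewrite exprn_gt0.
rewrite mulrA !exprMn.
have h1 := ler_wpM2l cp0 lop; have h2 := ler_wpM2l cq0 upq.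
have h3 := ler_wpM2l (ltW two0) MM.
rewrite -exprMn; apply: le_trans h1 _; rewrite exprMn.
set X := \prod_(z <- rp) _ in h3 *; set Y := \prod_(z <- rq) _ in h2 h3 *.
set Z := (\prod_(z <- rq) _) ^+ N in h2 *.
rewrite /K; move: h2 h3.
set a := A ^+ N; set b := normc _ ^+ N; set c := normc _ ^+ N.
move: (2 ^+ size rp) (2 ^+ size rq) => s t h2 h3; nra.
Qed.
End MinimumModulus.

(** * Zeros of polynomial solutions of the Jacobi equation *)

(** For [p != 0], the derivative of order [(size p).-1] is a nonzero constant. *)
Lemma derivn_root_eq0 (F : numDomainType) (p : {poly F}) z :
  (forall j, p^`(j).[z] = 0) -> p = 0.
Proof.
move=> pz; apply/eqP; apply: contraT => p0.
have : p^`((size p).-1) = (lead_coef p *+ (size p).-1`!)%:P.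
  apply/polyP => -[|i]; rewrite coef_derivn coefC ?addn0 ?ffactnn //=.
  by rewrite nth_default ?mul0rn // addnS -addSn prednK ?leq_addr // size_poly_gt0.
move/(congr1 (fun q => q.[z]))/esym; rewrite pz hornerC => /eqP.
by rewrite mulrn_eq0 lead_coef_eq0 (negPf p0) orbF eqn0Ngt fact_gt0.
Qed.

(** Jacobi's equation for parameters [a], [b] and degree [n] has [u = b - a], [v = a + b + 2] and
    [l = n (n + a + b + 1)]. Free coefficients keep the form stable under differentiation and base
    change. *)
Definition jacobi_ode (A : comNzRingType) (u v l : A) (p : {poly A}) : Prop :=
  (1 - 'X^2) * p^`(2) + (u%:P - v%:P * 'X) * p^`() + l%:P * p = 0.

Lemma jacobi_ode_horner (A : comNzRingType) (u v l z : A) (p2 p1 p : {poly A}) :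
  ((1 - 'X^2) * p2 + (u%:P - v%:P * 'X) * p1 + l%:P * p).[z]
    = (1 - z ^+ 2) * p2.[z] + (u - v * z) * p1.[z] + l * p.[z].
Proof.
by rewrite !(hornerD, hornerN, hornerM, hornerC, hornerXn, hornerX).
Qed.

(** Each differentiation raises [v] by 2 and lowers [l] by the current [v]; the decrements
    [v + 2 i], [i < j], add up to [j v + j (j - 1)]. *)
Lemma jacobi_ode_derivn (A : comNzRingType) (u v l : A) (p : {poly A}) j :
  jacobi_ode u v l p ->
  jacobi_ode u (v + (2 * j)%:R) (l - j%:R * v - (j * j.-1)%:R) p^`(j).
Proof.
move=> ode_p; elim: j => [|j IHj].
  by rewrite mul0r !muln0 !addr0 !subr0 derivn0.
have E : (j.+1 * j.+1.-1)%:R = (j * j.-1)%:R + (2 * j)%:R :> A.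
  by rewrite -natrD; congr _%:R; case: (j) => //= k; lia.
move: IHj; rewrite E mulnSr natrD /jacobi_ode -(addn1 j) (natrD _ j 1).
set w := (2 * j)%:R; set m := (j * _)%:R; set q := p^`(j).
have -> : p^`(j + 1) = q^`() by rewrite addn1 derivnS.
rewrite !derivnS derivn0 => /(congr1 (@deriv A)).
rewrite !(derivD, derivM, derivN, derivC, derivX, derivXn) /= => <-.
rewrite !(polyCD, polyCB, polyCM).
by ring.
Qed.

(** Logarithmic derivative of a split polynomial, used both to locate the roots and to bound [q'] by
    [q]. *)
Lemma horner_deriv_prod_XsubC (F : fieldType) (c : F) (rs : seq F) z :
  z \notin rs ->
  (c *: \prod_(w <- rs) ('X - w%:P))^`().[z]
    = (c *: \prod_(w <- rs) ('X - w%:P)).[z] * \sum_(w <- rs) (z - w)^-1.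
Proof.
move=> z_rs; rewrite derivZ !hornerZ -mulrA; congr (_ * _).
elim: rs z_rs => [|w rs IHrs]; first by rewrite !big_nil -polyC1 derivC !hornerE.
rewrite inE negb_or => /andP[zw /IHrs {}IHrs].
rewrite !big_cons derivM derivXsubC mul1r hornerD !hornerM IHrs hornerXsubC.
by move: zw; rewrite -subr_eq0; set P := (\prod_(_ <- _) _).[z] => zw; field.
Qed.

Lemma horner_deriv2_XsubC (A : comNzRingType) (p : {poly A}) z :
  (('X - z%:P) * p)^`(2).[z] = 2 * p^`().[z].
Proof.
rewrite !derivnS derivn0 derivM derivXsubC mul1r derivD derivM derivXsubC mul1r.
by rewrite !hornerD hornerM hornerXsubC subrr mul0r addr0 mulr_natl mulr2n.
Qed.

Section RootsOfJacobiODE.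
Context {R : realType}.
Local Notation C := R[i].
Implicit Types (z w : C) (q : {poly C}) (a b : R).

(** Where [1 - z^2] is nonzero, the differentiated equations determine each derivative at [z] from
    the two preceding ones; a double root would make all of them vanish. *)
Lemma simple_root_of_ode (u v l z : C) q : jacobi_ode u v l q -> q != 0 ->
  z ^+ 2 != 1 -> root q z -> q^`().[z] != 0.
Proof.
move=> ode_q q0 z1 /rootP qz; apply: contraNneq q0 => q'z; apply/eqP.
apply: (@derivn_root_eq0 _ _ z) => j.
suff: q^`(j).[z] = 0 /\ q^`(j.+1).[z] = 0 by case.
elim: j => [|j [IH0 IH1]]; first by rewrite derivn1.
split=> //; have := jacobi_ode_derivn j ode_q.
rewrite /jacobi_ode !derivnS derivn0 -!derivnS => /(congr1 (horner^~ z)).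
rewrite jacobi_ode_horner horner0 IH0 IH1 !mulr0 !addr0 => /eqP.
by rewrite mulf_eq0 subr_eq0 eq_sym (negPf z1) => /eqP.
Qed.

Lemma Re_inv_ge0 z : 0 <= complex.Re z -> 0 <= complex.Re z^-1.
Proof.
case: z => x y /= x0.
by rewrite mulr_ge0 ?invr_ge0 ?addr_ge0 ?sqr_ge0.
Qed.

Lemma Re_inv_gt0 z : 0 < complex.Re z -> 0 < complex.Re z^-1.
Proof.
case: z => x y /= x0.
by rewrite divr_gt0 // ltr_pwDl ?sqr_ge0 ?exprn_gt0.
Qed.

Lemma ReD z w : complex.Re (z + w) = complex.Re z + complex.Re w.
Proof. by case: z w => [x y] []. Qed.

Lemma ReN z : complex.Re (- z) = - complex.Re z.
Proof. by case: z. Qed.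

Lemma Re_realM (t : R) z : complex.Re (t%:C * z) = t * complex.Re z.
Proof. by case: z => x y /=; rewrite mul0r subr0. Qed.

Lemma exists_argmax (T : eqType) (f : T -> R) (s : seq T) x : x \in s ->
  exists2 y, y \in s & forall y', y' \in s -> f y' <= f y.
Proof.
elim: s x => // y s IHs x _; have [->|] := eqVneq s [::].
  by exists y; rewrite ?mem_head // => z; rewrite inE => /eqP->.
case: s IHs => // y' s /(_ y' (mem_head _ _)) [m m_s Hm] _.
have [le_ym|lt_my] := leP (f y) (f m).
  exists m; first by rewrite inE m_s orbT.
  by move=> z; rewrite inE => /predU1P[->//|/Hm].
exists y; first exact: mem_head.
by move=> z; rewrite inE => /predU1P[->//|/Hm/le_trans]; apply; apply: ltW.
Qed.

(* Stieltjes: at a root [z] the differential equation says that the sum of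
   [2 / (z - w)] over the other roots [w], plus [(a + 1) / (z - 1)] and
   [(b + 1) / (z + 1)], vanishes. So no root is extremal, in any direction [u],
   in the set of the roots and [1] and [-1]. *)
Lemma jacobi_ode_root_halfplane a b (l u z : C) q : -1 < a -> -1 < b ->
  jacobi_ode (b - a)%:C (a + b + 2)%:C l q -> q != 0 -> root q z ->
  complex.Re (u * z) <= `|complex.Re u|.
Proof.
move=> ha hb ode_q q0 qz; rewrite leNgt; apply/negP => uz.
have [rs Eq] := closed_field_poly_normal q.
have root_rs w : root q w = (w \in rs).
  by rewrite Eq rootZ ?lead_coef_eq0 // root_prod_XsubC.
(* [m] is a root farthest in the direction given by [u]; by assumption it lies strictly beyond [1]
   and [-1] in that direction. *)
have [m m_rs max_m] : exists2 m, m \in rs &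
    forall w, w \in rs -> complex.Re (u * w) <= complex.Re (u * m).
  by apply: (@exists_argmax _ (fun w => complex.Re (u * w)) rs z); rewrite -root_rs.
have um : `|complex.Re u| < complex.Re (u * m).
  by apply: (lt_le_trans uz); apply: max_m; rewrite -root_rs.
have u0 : u != 0.
  by apply: contraTneq um => ->; rewrite mul0r /= normr0 ltxx.
have um1 : 0 < complex.Re (u * (m - 1)).
  by rewrite mulrBr mulr1 ReD ReN subr_gt0; apply: le_lt_trans um; apply: ler_norm.
have um1' : 0 < complex.Re (u * (m + 1)).
  rewrite mulrDr mulr1 ReD -ltrBlDr sub0r.
  by apply: le_lt_trans um; rewrite -normrN; apply: ler_norm.
have m1 : m - 1 != 0 by apply: contraTneq um1 => ->; rewrite mulr0 ltxx.
have m1' : m + 1 != 0 by apply: contraTneq um1' => ->; rewrite mulr0 ltxx.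
have m2 : m ^+ 2 != 1 by rewrite -subr_eq0 subr_sqr_1 mulf_neq0.
have := simple_root_of_ode ode_q q0 m2; rewrite root_rs => /(_ m_rs) q'm.
have := perm_to_rem m_rs; set rs' := rem m rs => perm_rs.
set G := lead_coef q *: \prod_(w <- rs') ('X - w%:P).
have EG : q = ('X - m%:P) * G.
  by rewrite Eq (perm_big _ perm_rs) big_cons -scalerAr.
have q'E : q^`().[m] = G.[m].
  by rewrite EG derivM derivXsubC mul1r !hornerE subrr mul0r addr0.
have q''E : q^`(2).[m] = 2 * G^`().[m].
  by rewrite EG horner_deriv2_XsubC.
have mrs' : m \notin rs'.
  apply: contraNN q'm; rewrite q'E => mrs'.
  by rewrite -/(root G m) rootZ ?lead_coef_eq0 // root_prod_XsubC.
have G'E := horner_deriv_prod_XsubC (lead_coef q) mrs'.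
rewrite -/G in G'E.
have G0 : G.[m] != 0 by rewrite -q'E.
have qm0 : q.[m] = 0 by apply/rootP; rewrite root_rs.
have EC : (b - a)%:C = b%:C - a%:C by rewrite rmorphB.
have EC2 : (a + b + 2)%:C = a%:C + b%:C + 2.
  by rewrite -[2 in RHS](rmorph_nat (real_complex R)) -!rmorphD.
have := congr1 (fun p => p.[m]) ode_q.
rewrite EC EC2 jacobi_ode_horner horner0 qm0 q'E q''E G'E mulr0 addr0.
set Sg := \sum_(w <- rs') _ => ode_m.
(* The equation at [m], divided by [(1 - m^2) G(m)], where [q'(m) = G(m)] and [q''(m) = 2 G'(m)]. *)
have E : 2 * Sg + (b + 1)%:C / (m + 1) + (a + 1)%:C / (m - 1) = 0.
  apply: (mulfI G0); apply: (mulfI m1); apply: (mulfI m1').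
  have -> : (b + 1)%:C = b%:C + 1 by rewrite rmorphD rmorph1.
  have -> : (a + 1)%:C = a%:C + 1 by rewrite rmorphD rmorph1.
  rewrite !mulr0 -[RHS]oppr0 -ode_m.
  by field; rewrite m1 m1'.
(* After multiplication by [u^-1], every term is a positive multiple of the inverse of some
   [u (m - w)], [u (m + 1)] or [u (m - 1)]. Inversion preserves the sign of the real part, so the
   total real part is positive. *)
have := congr1 (fun x => complex.Re (u^-1 * x)) E.
rewrite mulr0 /= !mulrDr !ReD.
have -> : u^-1 * (2 * Sg) = 2%:C * \sum_(w <- rs') (u * (m - w))^-1.
  rewrite mulrCA (rmorph_nat (real_complex R)) mulr_sumr; congr (_ * _).
  by apply: eq_bigr => w _; rewrite invfM.
rewrite 2!(mulrCA u^-1) -!invfM !Re_realM => E'.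
have h1 : 0 <= complex.Re (\sum_(w <- rs') (u * (m - w))^-1).
  rewrite (big_morph _ ReD (erefl : complex.Re (0 : C) = 0)) big_seq.
  apply: sumr_ge0 => w w_rs'; apply: Re_inv_ge0.
  by rewrite mulrBr ReD ReN subr_ge0 max_m // (mem_rem w_rs').
have h2 := Re_inv_gt0 um1; have h3 := Re_inv_gt0 um1'.
nra.
Qed.

(** The directions [1] and [-1] bound the real part by 1 in absolute value, and ['i] and [- 'i]
    force the imaginary part to be 0. *)
Lemma jacobi_ode_root_segment a b (l z : C) q : -1 < a -> -1 < b ->
  jacobi_ode (b - a)%:C (a + b + 2)%:C l q -> q != 0 -> root q z ->
  z \in `[-1, 1].
Proof.
move=> ha hb ode_q q0 qz.
have H u := jacobi_ode_root_halfplane u ha hb ode_q q0 qz.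
have := H 1; have := H (-1); have := H 'i; have := H (- 'i).
case: z {qz H} => x y; rewrite in_itv /= !lecE /=.
rewrite !(oppr0, normr0, normrN, normr1, mul0r, mulr0, sub0r, subr0, add0r).
rewrite !(mul1r, mulN1r, opprK, oppr0, subr0) => y1 y2 x1 x2.
have -> : y = 0 by apply/eqP; rewrite eq_le; apply/andP; split; lra.
by rewrite eqxx /=; apply/andP; split; lra.
Qed.

(** The quotient [q' / q] at [z] is a sum of at most [n] terms [1 / (z - w)], each of modulus at
    most [1 / d]. *)
Lemma normc_deriv_le q z (d : R) n : 0 < d -> (size q <= n.+1)%N ->
  (forall w, root q w -> d <= normc (z - w)) ->
  normc q^`().[z] <= n%:R / d * normc q.[z].
Proof.
move=> d0 szq far; have [->|q0] := eqVneq q 0.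
  by rewrite deriv0 !horner0 normc0 mulr0.
have [rs Eq] := closed_field_poly_normal q.
have root_rs w : root q w = (w \in rs).
  by rewrite Eq rootZ ?lead_coef_eq0 // root_prod_XsubC.
have z_rs : z \notin rs.
  by rewrite -root_rs; apply/negP => /far; rewrite subrr normc0 leNgt d0.
rewrite {1}Eq horner_deriv_prod_XsubC // -Eq normcM mulrC.
apply: ler_wpM2r; first exact: normc_ge0.
have szrs : (size rs <= n)%N.
  by move: szq; rewrite Eq size_scale ?lead_coef_eq0 // size_prod_XsubC ltnS.
apply: le_trans (_ : \sum_(w <- rs) d^-1 <= _); last first.
  rewrite big_const_seq count_predT iter_addr_0 -[leLHS]mulr_natl.
  by rewrite ler_pM2r ?invr_gt0 // ler_nat.
have le_normc_sum (s : seq C) :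
    normc (\sum_(w <- s) (z - w)^-1) <= \sum_(w <- s) normc (z - w)^-1.
  elim: s => [|w s IHs]; first by rewrite !big_nil normc0.
  by rewrite !big_cons (le_trans (le_normcD _ _)) // lerD2l.
apply: (le_trans (le_normc_sum rs)); rewrite big_seq [leRHS]big_seq.
apply: ler_sum => w w_rs; rewrite normcV lef_pV2 ?posrE //.
  by apply: far; rewrite root_rs.
by apply: lt_le_trans d0 (far _ _); rewrite root_rs.
Qed.

Lemma segment_dist z : z \notin `[-1, 1] ->
  exists2 d : R, 0 < d & forall w, w \in `[-1, 1] -> d <= normc (z - w).
Proof.
case: z => x y; rewrite in_itv /= !lecE /= => z_notin.
have hyp (s t : R) : `|s| <= Num.sqrt (s ^+ 2 + t ^+ 2).
  by rewrite -sqrtr_sqr ler_wsqrtr // lerDl sqr_ge0.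
(* Positive off the segment: if [y = 0], then [z] is real with absolute value above 1. *)
exists (Num.max `|y| (`|x| - 1)).
  rewrite lt_max normr_gt0 subr_gt0; have [y0|//] := eqVneq y 0.
  by move: z_notin; rewrite y0 oppr0 eqxx /= -ler_norml ltNge.
case=> s t; rewrite in_itv /= !lecE /= => /andP[/andP[/eqP-> s1] /andP[_ s2]].
rewrite oppr0 subr0 ge_max; apply/andP; split.
  by rewrite addrC hyp.
apply: le_trans (hyp _ _); rewrite lerBlDr.
apply: le_trans (_ : `|x - s| + `|s| <= _); last by rewrite lerD2l ler_norml s1.
by rewrite -{1}(subrK s x) ler_normD.
Qed.
End RootsOfJacobiODE.

(** * Jacobi polynomials *)

Lemma jacobi_odeZ (A : comNzRingType) (u v l c : A) (p : {poly A}) :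
  jacobi_ode u v l p -> jacobi_ode u v l (c%:P * p).
Proof.
rewrite /jacobi_ode !derivnS derivn0 !derivM derivC !mul0r !add0r.
rewrite derivM derivC mul0r add0r => E.
by rewrite -[RHS](mulr0 c%:P) -E; ring.
Qed.

Section JacobiPolynomials.
Context {R : realType}.
Local Notation C := R[i].
Implicit Types (a b x d M : R) (n j k : nat).

Lemma gbinomS x k : gbinom x k.+1 * k.+1%:R = gbinom x k * (x - k%:R).
Proof.
rewrite /gbinom big_ord_recr /= factS natrM.
have k0 : k.+1%:R != 0 :> R by rewrite pnatr_eq0.
have f0 : k`!%:R != 0 :> R by rewrite pnatr_eq0 -lt0n fact_gt0.
by set p := \prod_(i < k) _; field; rewrite f0 addrC natr1 k0.
Qed.

Lemma gbinom_gt0 x k : k%:R < x + 1 -> 0 < gbinom x k.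
Proof.
move=> kx; rewrite divr_gt0 ?ltr0n ?fact_gt0 // prodr_gt0 // => i _.
rewrite subr_gt0; have : i.+1%:R <= k%:R :> R by rewrite ler_nat.
by rewrite -natr1; lra.
Qed.

Lemma deriv_XsubC_exp (c : R) k :
  (('X - c%:P) ^+ k)^`() = k%:R%:P * ('X - c%:P) ^+ k.-1.
Proof. by rewrite deriv_exp derivXsubC mul1r polyC_natr mulr_natl. Qed.

Lemma XsubC_mul_deriv (c : R) k :
  ('X - c%:P) * (('X - c%:P) ^+ k)^`() = k%:R%:P * ('X - c%:P) ^+ k.
Proof.
rewrite deriv_XsubC_exp; case: k => [|k]; first by rewrite !mul0r mulr0.
by rewrite mulrCA -exprS.
Qed.

Lemma XsubC_mul_deriv2 (c x : R) k :
  ('X - c%:P) * (('X - c%:P) ^+ k)^`()^`()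
    + (x + 1)%:P * (('X - c%:P) ^+ k)^`()
  = (k%:R * (k%:R + x))%:P * ('X - c%:P) ^+ k.-1.
Proof.
rewrite deriv_XsubC_exp derivM derivC mul0r add0r mulrCA XsubC_mul_deriv.
case: k => [|k]; first by rewrite !mul0r mulr0 addr0.
by rewrite /= -natr1 !(polyCD, polyCM); ring.
Qed.

Lemma jacobi_ode_monomial a b k j :
  let p i := ('X - 1%:P) ^+ i : {poly R} in
  let q i := ('X - (-1)%:P) ^+ i : {poly R} in
  (1 - 'X^2) * (p k * q j)^`(2)
    + ((b - a)%:P - (a + b + 2)%:P * 'X) * (p k * q j)^`()
  = - ((k%:R * (k%:R + a))%:P * (p k.-1 * q j.+1)
       + (j%:R * (j%:R + b))%:P * (p k.+1 * q j.-1)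
       + (2 * k%:R * j%:R + (a + 1) * j%:R + (b + 1) * k%:R)%:P * (p k * q j)).
Proof.
move=> p q.
have := XsubC_mul_deriv2 1 a k; have := XsubC_mul_deriv2 (-1) b j.
have := XsubC_mul_deriv 1 k; have := XsubC_mul_deriv (-1) j.
rewrite /p /q !exprS !derivnS derivn0 !derivM !derivD !derivM.
set f := ('X - 1%:P) ^+ k; set g := ('X - (-1)%:P) ^+ j.
set f1 := f^`(); set g1 := g^`(); set f2 := f1^`(); set g2 := g1^`().
rewrite (_ : 'X - (-1)%:P = 'X + 1); last by rewrite polyCN opprK.
rewrite polyC1.
move=> g1E f1E g2E f2E.
rewrite mulrA [_ * ('X + 1) ^+ _]mulrC.
(* Writing ['X^2 - 1] as a product and the first-order coefficient as
   [- ((a + 1) (X + 1) + (b + 1) (X - 1))] isolates the combinations known for each factor. *)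
transitivity (- (('X + 1) * g * (('X - 1) * f2 + (a + 1)%:P * f1)
   + ('X - 1) * f * (('X + 1) * g2 + (b + 1)%:P * g1)
   + (a + 1)%:P * f * (('X + 1) * g1) + (b + 1)%:P * g * (('X - 1) * f1)
   + 2 * (('X - 1) * f1) * (('X + 1) * g1))).
  by rewrite !(polyCD, polyCB, polyC1); ring.
by rewrite g1E f1E g2E f2E !(polyCD, polyCM, polyC1); ring.
Qed.

Lemma jacobiE a b n : jacobi a b n =
  (2 ^- n)%:P * \sum_(j < n.+1) (gbinom (n%:R + a) j * gbinom (n%:R + b) (n - j))%:P
     * (('X - 1%:P) ^+ (n - j) * ('X - (-1)%:P) ^+ j).
Proof.
rewrite /jacobi mul_polyC; congr (_ *: _); apply: eq_bigr => j _.
by rewrite mul_polyC polyCN opprK.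
Qed.

Lemma jacobi_satisfies_ode a b n :
  jacobi_ode (b - a) (a + b + 2) (n%:R * (n%:R + a + b + 1)) (jacobi a b n).
Proof.
rewrite jacobiE; apply: jacobi_odeZ; rewrite /jacobi_ode.
set c := fun j => gbinom (n%:R + a) j * gbinom (n%:R + b) (n - j).
pose m k j : {poly R} := ('X - 1%:P) ^+ k * ('X - (-1)%:P) ^+ j.
(* This two-term recurrence matches the contribution of index [j] to the monomial of index [j.+1],
   and conversely. *)
have cS j : (j < n)%N -> c j * ((n - j)%:R * ((n - j)%:R + a))
    = c j.+1 * (j.+1%:R * (j.+1%:R + b)).
  move=> lt_jn; rewrite /c; have [k Ek] : exists k, (n - j = k.+1)%N.
    by exists (n - j.+1)%N; rewrite subnSK.
  have -> : (n - j.+1 = k)%N by lia.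
  have En : n%:R = j%:R + k%:R + 1 :> R by rewrite -natrD natr1; congr _%:R; lia.
  rewrite Ek; transitivity (gbinom (n%:R + a) j * (gbinom (n%:R + b) k.+1 * k.+1%:R)
      * (k.+1%:R + a)); first by ring.
  rewrite gbinomS; transitivity (gbinom (n%:R + a) j.+1 * j.+1%:R
      * gbinom (n%:R + b) k * (j.+1%:R + b)); last by ring.
  by rewrite gbinomS En -!natr1; ring.
rewrite !derivnS derivn0 !(raddf_sum deriv) !mulr_sumr -!big_split /=.
transitivity (\sum_(j < n.+1) - (
   (c j * ((n - j)%:R * ((n - j)%:R + a)))%:P * m (n - j).-1 j.+1
   + (c j * (j%:R * (j%:R + b)))%:P * m (n - j).+1 j.-1
   + (c j * (2 * (n - j)%:R * j%:R + (a + 1) * j%:R + (b + 1) * (n - j)%:R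
       - n%:R * (n%:R + a + b + 1)))%:P * m (n - j)%N j)).
  apply: eq_bigr => -[j /= lt_jn] _; have := jacobi_ode_monomial a b (n - j) j.
  rewrite /= -!/(m _ _) -/(c j) !(derivM (c j)%:P) !derivC !mul0r !add0r.
  rewrite (derivM (c j)%:P) derivC mul0r add0r.
  move: (m (n - j)%N j)^`() (m (n - j)%N j)^`()^`() => m1 m2 Em.
  transitivity ((c j)%:P * ((1 - 'X^2) * m2 + ((b - a)%:P - (a + b + 2)%:P * 'X) * m1)
    + (c j)%:P * (n%:R * (n%:R + a + b + 1))%:P * m (n - j)%N j).
    by ring.
  by rewrite Em !(polyCD, polyCM, polyCN); ring.
rewrite sumrN; apply/eqP; rewrite oppr_eq0; apply/eqP.
rewrite !big_split /= big_ord_recr /= subnn !(mul0r, mulr0) addr0.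
(* Both shifted sums are reindexed to the monomials [m (n - j) j]; the boundary terms, [j = n] in
   one and [j = 0] in the other, have coefficient 0. *)
transitivity (\sum_(j < n.+1) (c j * (j%:R * (j%:R + b)))%:P * m (n - j)%N j
  + \sum_(j < n.+1) (c j * ((n - j)%:R * ((n - j)%:R + a)))%:P * m (n - j)%N j
  + \sum_(j < n.+1) (c j * (2 * (n - j)%:R * j%:R + (a + 1) * j%:R
      + (b + 1) * (n - j)%:R - n%:R * (n%:R + a + b + 1)))%:P * m (n - j)%N j).
  congr (_ + _ + _).
    rewrite [RHS]big_ord_recl /= !(mul0r, mulr0) add0r.
    by apply: eq_bigr => j _; rewrite cS // /bump /= subnS.
  rewrite big_ord_recl /= [RHS]big_ord_recr /= subnn !(mul0r, mulr0) add0r addr0.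
  apply: eq_bigr => j _; rewrite cS // /bump /=.
  by congr (_ * m _ _); have := ltn_ord j; lia.
rewrite -!big_split /= big1 // => -[j /= lt_jn] _.
rewrite -!mulrDl -!polyCD -!mulrDr natrB //.
set x := (X in c j * X); suff -> : x = 0 by rewrite mulr0 mul0r.
by rewrite /x; ring.
Qed.

(** * Degree bound and non-vanishing of Jacobi polynomials and their derivatives *)

Lemma size_jacobi_le a b n : (size (jacobi a b n) <= n.+1)%N.
Proof.
rewrite jacobiE mul_polyC; apply: leq_trans (size_scale_leq _ _) _.
apply: leq_trans (size_sum _ _ _) _; apply/bigmax_leqP => -[j /= lt_jn] _.
rewrite mul_polyC; apply: leq_trans (size_scale_leq _ _) _.
rewrite size_Mmonic ?expf_neq0 ?polyXsubC_eq0 ?monic_exp ?monicXsubC //.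
by rewrite !size_exp_XsubC; lia.
Qed.

(** At [r] only the last term survives, so its coefficient is 0; then divide by ['X - r%:P] and
    induct. *)
Lemma sum_XsubC_exp_eq0 (r s : R) (c : nat -> R) n : r != s ->
  \sum_(j < n.+1) (c j)%:P * (('X - r%:P) ^+ (n - j) * ('X - s%:P) ^+ j) = 0 ->
  forall j, (j <= n)%N -> c j = 0.
Proof.
move=> rs; elim: n => [|n IHn].
  rewrite big_ord1 !expr0 !mulr1 => /eqP; rewrite polyC_eq0 => /eqP c0 j.
  by rewrite leqn0 => /eqP->.
rewrite big_ord_recr /= subnn expr0 mul1r.
under eq_bigr => j _ do rewrite subSn ?leq_ord // exprS -mulrA mulrCA.
rewrite -mulr_sumr => sum0.
have cn0 : c n.+1 = 0.
  have /eqP := congr1 (fun p => p.[r]) sum0.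
  rewrite hornerD !hornerM horner_exp !hornerXsubC subrr mul0r add0r hornerC horner0.
  by rewrite mulf_eq0 expf_eq0 /= subr_eq0 (negPf rs) orbF => /eqP.
move: sum0; rewrite cn0 mul0r addr0 => /eqP; rewrite mulf_eq0 polyXsubC_eq0 /=.
move=> /eqP /IHn c0 j; rewrite leq_eqVlt => /predU1P[->//|]; exact: c0.
Qed.

Lemma exists_natr_ge x : exists n0 : nat, forall n, (n0 <= n)%N -> x <= n%:R.
Proof.
exists (Num.bound `|x|) => n le_n0n; apply: le_trans (ler_norm x) _.
apply: le_trans (_ : (Num.bound `|x|)%:R <= _); last by rewrite ler_nat.
by rewrite ltW // archi_boundP.
Qed.

(** The coefficient of index [n./2] is positive: both [n./2] and [n - n./2] are at most [n - r - 1],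
    so all factors of the two binomials are positive. *)
Lemma jacobi_neq0 a b r n : -1 < a + r%:R -> -1 < b + r%:R ->
  (2 * r + 4 <= n)%N -> jacobi a b n != 0.
Proof.
move=> ha hb le_rn; rewrite jacobiE mulf_neq0 ?polyC_eq0 ?invr_neq0 ?expf_neq0 //.
apply/eqP => /(@sum_XsubC_exp_eq0 _ _ (fun j => gbinom _ j * gbinom _ (n - j))).
have m11 : 1 != -1 :> R by rewrite -subr_eq0 opprK (_ : 1 + 1 = 2) ?pnatr_eq0.
have half_le : (n./2 <= n)%N by have := odd_double_half n; lia.
move/(_ m11 n./2 half_le) => /eqP; apply/negP.
have bound k (x : R) : -1 < x + r%:R -> (k + r + 1 <= n)%N ->
    0 < gbinom (n%:R + x) k.
  move=> hx le_k; apply: gbinom_gt0.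
  have : (k + r + 1)%:R <= n%:R :> R by rewrite ler_nat.
  by rewrite !natrD; lra.
by rewrite mulf_neq0 // gt_eqF // bound //; have := odd_double_half n; lia.
Qed.

(** These are the Jacobi coefficients for the parameters [a + j] and [b + j]; the factored
    eigenvalue shows its sign and size. *)
Lemma jacobi_derivn_ode a b n j :
  jacobi_ode (b - a) (a + b + 2 + (2 * j)%:R)
    ((n%:R - j%:R) * (n%:R + j%:R + a + b + 1)) (jacobi a b n)^`(j).
Proof.
have := jacobi_ode_derivn j (jacobi_satisfies_ode a b n); congr jacobi_ode.
by case: j => [|j] /=; rewrite ?natrM -?natr1; ring.
Qed.

(** If the derivative of order [j.+1] vanishes, the equation for order [j] reduces to its eigenvalue
    term, and the eigenvalue is nonzero for large [n]; so order [j] vanishes too. *)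
Lemma jacobi_derivn_neq0 a b r : -1 < a + r%:R -> -1 < b + r%:R ->
  exists n0 : nat, forall n, (n0 <= n)%N -> (jacobi a b n)^`(r) != 0.
Proof.
move=> ha hb; exists (2 * r + 4)%N => n le_n.
have := jacobi_neq0 ha hb le_n; elim: {-2}(r) (leqnn r) => [|j IHj] lt_jr Pn0 //.
move: (IHj (ltnW lt_jr) Pn0); apply: contra => /eqP Pj1.
have := jacobi_derivn_ode a b n j.
rewrite /jacobi_ode !derivnS derivn0 -!derivnS derivnS Pj1 deriv0 !mulr0 !add0r.
move/eqP; rewrite mulf_eq0 polyC_eq0 mulf_eq0 => /orP[|//].
have : (2 * r + 4)%:R <= n%:R :> R by rewrite ler_nat.
have : j.+1%:R <= r%:R :> R by rewrite ler_nat.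
have j0 : 0 <= j%:R :> R by [].
rewrite -natr1 natrD natrM => h1 h2.
by case/orP => /eqP h3; lra.
Qed.

(** * Complex zeros and size of the derivatives of Jacobi polynomials *)

Lemma cpoly_derivn (p : {poly R}) j : (cpoly p)^`(j) = cpoly p^`(j).
Proof. exact: derivn_map. Qed.

Lemma jacobi_ode_cpoly (u v l : R) (p : {poly R}) :
  jacobi_ode u v l p -> jacobi_ode u%:C v%:C l%:C (cpoly p).
Proof.
move=> /(congr1 (map_poly (real_complex R))).
rewrite /jacobi_ode cpoly_derivn -[(cpoly p)^`()]derivn1 cpoly_derivn /cpoly.
by rewrite rmorph0 !rmorphD !rmorphM !rmorphB !rmorphM /= !map_polyC !map_polyX rmorph1.
Qed.

Lemma jacobi_derivn_root a b r : -1 < a + r%:R -> -1 < b + r%:R ->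
  exists n0 : nat, forall n, (n0 <= n)%N ->
    forall z : C, root (cpoly (jacobi a b n))^`(r) z -> z \in `[-1, 1].
Proof.
move=> ha hb; have [n0 Pr0] := jacobi_derivn_neq0 ha hb.
exists n0 => n /Pr0 Pnr z; apply: (jacobi_ode_root_segment ha hb).
  have -> : b + r%:R - (a + r%:R) = b - a by ring.
  have -> : a + r%:R + (b + r%:R) + 2 = a + b + 2 + (2 * r)%:R.
    by rewrite natrM; ring.
  rewrite cpoly_derivn; exact: jacobi_ode_cpoly (jacobi_derivn_ode a b n r).
by rewrite cpoly_derivn map_poly_eq0.
Qed.

Lemma jacobi_derivn_bound a b r d M : -1 < a + r%:R -> -1 < b + r%:R -> 0 < d ->
  exists E : R, 0 < E /\ exists n0 : nat, forall n, (n0 <= n)%N ->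
    forall z : C, normc z <= M -> (forall w, w \in `[-1, 1] -> d <= normc (z - w)) ->
    forall j, (j < r)%N ->
      normc (cpoly (jacobi a b n))^`(j).[z]
        <= E / n%:R * normc (cpoly (jacobi a b n))^`(r).[z].
Proof.
move=> ha hb d0; have [n1 Hroot] := jacobi_derivn_root ha hb.
(* [M1] and [M2] bound the coefficients of the second and first derivatives for [|z| <= M]. In [E],
   the 4 comes from an eigenvalue of at least [n^2 / 4], and [1 + d^-1] lets one bound serve two
   consecutive derivatives. *)
pose M1 : R := 1 + M ^+ 2.
pose M2 : R := `|b - a| + (`|a + b + 2| + (2 * r)%:R) * `|M|.
pose E : R := 4 * (M1 + M2) * (1 + d^-1).
have M10 : 0 < M1 by rewrite ltr_pwDl ?sqr_ge0.
have M20 : 0 <= M2 by rewrite addr_ge0 ?mulr_ge0 ?addr_ge0.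
have dV0 : 0 < d^-1 by rewrite invr_gt0.
exists E; split; first by rewrite /E; apply: mulr_gt0; first apply: mulr_gt0 => //; lra.
(* [n2] ensures [E / n <= 1]; [n3] makes both factors of the eigenvalue at least [n / 2]. *)
have [n2 Hn2] := exists_natr_ge E.
have [n3 Hn3] := exists_natr_ge (2 * r%:R + 2 * `|a + b + 1| + 1).
exists (maxn n1 (maxn n2 n3)) => n; rewrite !geq_max => /and3P[/Hroot {}Hroot].
move=> /Hn2 nE /Hn3 nl z zM zd.
set P := cpoly _ in Hroot *; set NQ := normc P^`(r).[z].
have NQ0 : 0 <= NQ by apply: normc_ge0.
have ab0 : 0 <= `|a + b + 1| by [].
have r0 : 0 <= r%:R :> R by [].
have n0 : 1 <= n%:R :> R by lra.
have nd1 : 1 <= n%:R * (1 + d^-1).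
  by rewrite mulrDr mulr1 ler_wpDr // mulr_ge0 // ltW.
have Q1 : normc P^`(r.+1).[z] <= n%:R / d * NQ.
  rewrite derivnS; apply: normc_deriv_le d0 _ _ => [|w /Hroot]; last exact: zd.
  have: (size P <= n.+1)%N by rewrite size_map_poly size_jacobi_le.
  apply: leq_trans; elim: (r) => //= k IHk; apply: leq_trans IHk.
  exact: leq_trans (size_poly _ _) (leq_pred _).
have step j : (j < r)%N -> normc P^`(j.+1).[z] <= NQ ->
    normc P^`(j.+2).[z] <= n%:R * (1 + d^-1) * NQ ->
    normc P^`(j).[z] <= E / n%:R * NQ.
  move=> lt_jr Pj1 Pj2.
  have jr : j%:R + 1 <= r%:R :> R by rewrite natr1 ler_nat.
  have j0 : 0 <= j%:R :> R by [].
  have := congr1 (fun p => p.[z]) (jacobi_ode_cpoly (jacobi_derivn_ode a b n j)).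
  rewrite -cpoly_derivn -/P.
  rewrite !(derivnS, derivn0) -!derivnS jacobi_ode_horner horner0.
  set l := (n%:R - _) * _; set u := (b - a)%:C; set v := (a + b + 2 + _)%:C.
  move/eqP; rewrite addrC addr_eq0 => /eqP lE.
  have l_ge : n%:R ^+ 2 / 4 <= l.
    have /andP[ab1 ab2] : - `|a + b + 1| <= a + b + 1 <= `|a + b + 1|.
      by rewrite -ler_norml.
    have e1 : n%:R / 2 <= n%:R - j%:R :> R by lra.
    have e2 : n%:R / 2 <= n%:R + j%:R + a + b + 1 :> R by lra.
    apply: le_trans (_ : n%:R / 2 * (n%:R / 2) <= _); first by rewrite expr2; lra.
    by rewrite /l ler_pM //; lra.
  have l0 : 0 < l by apply: lt_le_trans l_ge; rewrite divr_gt0 ?exprn_gt0 //; lra.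
  have lP : l * normc P^`(j).[z] <= M1 * normc P^`(j.+2).[z] + M2 * normc P^`(j.+1).[z].
    have -> : l * normc P^`(j).[z] = normc (l%:C * P^`(j).[z]).
      by rewrite normcM normc_real gtr0_norm.
    rewrite lE normcN; apply: le_trans (le_normcD _ _) _; rewrite !normcM.
    have zM' : normc z <= `|M| by apply: le_trans zM (ler_norm _).
    apply: lerD; apply: ler_wpM2r; rewrite ?normc_ge0 //.
      apply: le_trans (le_normcD _ _) _; rewrite normc1 normcN normcX lerD2l.
      by rewrite -(real_normK (num_real M)) lerXn2r ?nnegrE ?normc_ge0.
    apply: le_trans (le_normcD _ _) _; rewrite normcN normcM !normc_real lerD2l.
    apply: ler_pM; rewrite ?normr_ge0 ?normc_ge0 //.
    apply: le_trans (ler_normD _ _) _.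
    by rewrite lerD2l ger0_norm // ler_nat leq_mul2l ltnW.
  have {}lP : l * normc P^`(j).[z] <= n%:R * (M1 + M2) * (1 + d^-1) * NQ.
    apply: le_trans lP _.
    apply: le_trans (_ : M1 * (n%:R * (1 + d^-1) * NQ) + M2 * (n%:R * (1 + d^-1) * NQ) <= _).
      apply: lerD; apply: ler_wpM2l => //; first exact: ltW.
      apply: le_trans Pj1 _; by rewrite -{1}(mul1r NQ) ler_wpM2r.
    by rewrite -mulrDl; lra.
  have : n%:R ^+ 2 / 4 * normc P^`(j).[z] <= n%:R * (M1 + M2) * (1 + d^-1) * NQ.
    by apply: le_trans lP; rewrite ler_wpM2r // normc_ge0.
  have nn0 : 0 < n%:R :> R by lra.
  rewrite -(ler_pM2l (_ : 0 < 4 / n%:R ^+ 2)); last by rewrite divr_gt0 ?exprn_gt0.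
  congr (_ <= _).
    by field; rewrite gt_eqF.
  by rewrite /E; field; rewrite !gt_eqF.
have En1 : E / n%:R <= 1 by rewrite ler_pdivrMr ?mul1r //; lra.
(* Descending induction from order [r], carrying the two consecutive bounds that [step] consumes;
   [E / n <= 1] feeds its conclusion back in. *)
have claim h : (h <= r)%N -> normc P^`(r - h).[z] <= NQ /\
    normc P^`((r - h).+1).[z] <= n%:R * (1 + d^-1) * NQ.
  elim: h => [|h IHh] hr.
    rewrite subn0; split=> //; apply: le_trans Q1 _; rewrite ler_wpM2r //.
    by rewrite ler_wpM2l ?lerDr //; lra.
  have [|IH1 IH2] := IHh; first exact: ltnW.
  have Ej : ((r - h) = (r - h.+1).+1)%N by rewrite subnSK.
  rewrite Ej in IH1 IH2; have := step (r - h.+1)%N _ IH1 IH2.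
  rewrite ltn_subrL; have -> : (0 < r)%N by apply: leq_trans hr.
  move=> /(_ isT) st; split; first by apply: le_trans st _; rewrite ler_piMl.
  apply: le_trans IH1 _; by rewrite -{1}(mul1r NQ) ler_wpM2r.
move=> j lt_jr; apply: step => //.
  have [] := claim (r - j.+1)%N (leq_subr _ _); by rewrite subKn.
have := claim (r - j.+1)%N (leq_subr _ _); by rewrite subKn // => -[].
Qed.
End JacobiPolynomials.

(** * Divisibility of the Wronskian by powers of 1 + x *)

(** Among [n + 1] distinct naturals one is at least [n]; remove it and induct. *)
Lemma bin2_leq_sumn (s : seq nat) : uniq s -> ('C(size s, 2) <= sumn s)%N.
Proof.
elim: {s}(size s) {-2}s (erefl (size s)) => [|n IHn] s szs uniq_s; first by rewrite szs.
have /hasP[x x_s le_nx] : has (leq n) s.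
  apply: contraT => /hasPn small.
  have := uniq_leq_size uniq_s (_ : {subset s <= iota 0 n}).
  rewrite size_iota szs ltnn => -> // y y_s.
  by rewrite mem_iota add0n ltnNge small.
have perm_s := perm_to_rem x_s.
rewrite szs (perm_sumn perm_s) /= binS bin1 addnC leq_add //.
have sz_rem : size (rem x s) = n by rewrite size_rem ?szs.
by rewrite -{1}sz_rem IHn ?rem_uniq.
Qed.

Section WronskianDivisibility.
Context {R : realFieldType}.
Implicit Types (c : R) (p : {poly R}).

(* The [i]-th derivative of [t `^ (- c) * p] is [t `^ (- c - i) * euler c p i],
   where [t = 1 + x]. *)
Fixpoint euler c p i : {poly R} :=
  if i is k.+1
  then ('X + 1) * (euler c p k)^`() - (c + k%:R)%:P * euler c p k
  else p.

Lemma euler_sum c (I : Type) (s : seq I) (k : I -> R) (F : I -> {poly R}) i :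
  euler c (\sum_(e <- s) (k e)%:P * F e) i = \sum_(e <- s) (k e)%:P * euler c (F e) i.
Proof.
elim: i => //= i ->.
rewrite raddf_sum !mulr_sumr -sumrB; apply: eq_bigr => e _ /=.
by rewrite derivM derivC; ring.
Qed.

(** Powers of ['X + 1] are eigenvectors of [('X + 1) d/dX], so step [k] multiplies by
    [e - c - k]. *)
Lemma euler_exp c e i :
  euler c (('X + 1) ^+ e) i = (\prod_(k < i) (e%:R - c - k%:R))%:P * ('X + 1) ^+ e.
Proof.
elim: i => [|i IHi]; first by rewrite big_ord0 mul1r.
rewrite /= IHi big_ord_recr /= derivM derivC mul0r add0r.
have E : ('X + 1) * (('X + 1) ^+ e)^`() = e%:R%:P * ('X + 1) ^+ e :> {poly R}.
  rewrite deriv_exp derivD derivX -polyC1 derivC addr0 mul1r.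
  by case: e {IHi} => [|e]; rewrite ?mulr0n ?mulr0 ?mul0r // mulrnAr -exprS polyC_natr mulr_natl.
rewrite mulrCA E !(polyCM, polyCB, polyCD); ring.
Qed.

Lemma euler0E p i : euler 0 p i = ('X + 1) ^+ i * p^`(i).
Proof.
elim: i => [|i IHi]; first by rewrite expr0 mul1r derivn0.
rewrite /= IHi derivM deriv_exp derivD derivX -polyC1 derivC addr0 mul1r add0r polyC1.
rewrite polyC_natr; case: i {IHi} => [|i]; first by rewrite !expr0 expr1; ring.
by rewrite /= !exprS; ring.
Qed.

(** Taylor expansion at [-1]; [M] may exceed the size, so that all columns share one range of
    exponents. *)
Lemma poly_pow_expansion p M : (size p <= M)%N ->
  p = \sum_(e < M) ((p \Po ('X - 1%:P))`_e)%:P * ('X + 1) ^+ e.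
Proof.
move=> szp; rewrite -{1}[p](comp_polyXaddC_K p (-1)) polyCN opprK polyC1.
rewrite comp_polyE.
have szq : size (p \Po ('X - 1)) = size p.
  by rewrite -[1]polyC1 size_comp_poly2 // size_XsubC.
rewrite szq (big_ord_widen _ (fun e => (p \Po ('X - 1))`_e *: ('X + 1) ^+ e) szp).
rewrite big_mkcond /=; apply: eq_bigr => e _; rewrite mul_polyC.
by case: ltnP => // le_e; rewrite nth_default ?scale0r ?szq.
Qed.

(** Multilinearity in the columns: [f] chooses one power of ['X + 1] in each. Transposing makes the
    Leibniz products run over columns. *)
Lemma det_sum_columns n M (c : 'I_n -> 'I_M -> R) (A : 'I_n -> 'I_M -> 'I_n -> R) :
  \det (\matrix_(i, j) \sum_(e < M) (c j e)%:P * ((A i e j)%:P * ('X + 1) ^+ e))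
  = \sum_(f : {ffun 'I_n -> 'I_M})
      (\prod_j (c j (f j)) * \det (\matrix_(i, j) A i (f j) j))%:P
        * ('X + 1) ^+ (\sum_j f j).
Proof.
under [RHS]eq_bigr => f _ do rewrite -det_tr.
rewrite -[LHS]det_tr /determinant.
transitivity (\sum_(s : {perm 'I_n}) \sum_(f : {ffun 'I_n -> 'I_M}) (-1) ^+ s *
  \prod_j ((c j (f j))%:P * ((A (s j) (f j) j)%:P * ('X + 1) ^+ f j))).
  apply: eq_bigr => s _; rewrite -mulr_sumr; congr (_ * _).
  rewrite -(bigA_distr_bigA (fun j e => (c j e)%:P * ((A (s j) e j)%:P * ('X + 1) ^+ e))).
  by apply: eq_bigr => j _; rewrite !mxE.
rewrite exchange_big /=; apply: eq_bigr => f _.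
rewrite mulr_sumr rmorph_sum mulr_suml; apply: eq_bigr => s _.
rewrite !big_split /= -expr_sum !rmorphM !rmorph_prod rmorph_sign /= mulrCA !mulrA.
have -> : \prod_j ((\matrix_(i, k) A i (f k) k)^T j (s j))%:P
    = \prod_j (A (s j) (f j) j)%:P :> {poly R}.
  by apply: eq_bigr => j _; rewrite !mxE.
by congr (_ * _); rewrite -[RHS]mulrA [RHS]mulrC.
Qed.

(* Expand each column in powers of [1 + X]: a term vanishes unless the exponents
   are distinct within each group of columns, and [k] distinct naturals sum to at
   least ['C(k, 2)]. *)
Lemma dvdp_det_euler n (l : 'I_n -> R * {poly R}) (g : 'I_n -> bool) :
  (forall i j, g i = g j -> (l i).1 = (l j).1) ->
  ('X + 1) ^+ ('C(#|[set j | g j]|, 2) + 'C(#|[set j | ~~ g j]|, 2))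
    %| \det (\matrix_(i < n, j < n) euler (l j).1 (l j).2 i).
Proof.
move=> gl; pose M := \max_j size (l j).2.
have szM j : (size (l j).2 <= M)%N by apply: (leq_bigmax j).
pose c (j : 'I_n) (e : 'I_M) := ((l j).2 \Po ('X - 1%:P))`_e.
pose A (i : 'I_n) (e : 'I_M) (j : 'I_n) := \prod_(k < i) (e%:R - (l j).1 - k%:R).
rewrite (_ : (\matrix_(i < n, j < n) _) = \matrix_(i, j) \sum_(e < M)
    (c j e)%:P * ((A i e j)%:P * ('X + 1) ^+ e)); last first.
  apply/matrixP => i j; rewrite !mxE {1}(poly_pow_expansion (szM j)) euler_sum.
  by apply: eq_bigr => e _; rewrite euler_exp.
rewrite det_sum_columns.
apply: (big_ind (fun p => _ %| p)) => [|p q|f _]; rewrite ?dvdp0 //; first exact: dvdp_add.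
have [inj|] := boolP [forall j, forall k, (g j == g k) && (f j == f k) ==> (j == k)].
  apply/dvdp_mull/dvdp_exp2l.
  have sum_ge (P : pred 'I_n) : {in P &, forall j k, g j = g k} ->
      ('C(#|P|, 2) <= \sum_(j | P j) f j)%N.
    move=> gP; have := @bin2_leq_sumn [seq val (f j) | j <- enum P].
    rewrite size_map -cardE sumnE big_map big_enum; apply.
    rewrite map_inj_in_uniq ?enum_uniq // => j k.
    rewrite !mem_enum => jP kP /val_inj fjk.
    have /forallP/(_ j)/forallP/(_ k) := inj.
    by rewrite (gP j k jP kP) fjk !eqxx => /eqP.
  rewrite (bigID g) /= leq_add //.
    by rewrite cardsE; apply: (sum_ge g) => j k; rewrite /in_mem /= => -> ->.
  rewrite cardsE; apply: (sum_ge (fun j => ~~ g j)) => j k.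
  by rewrite /in_mem /= => /negPf-> /negPf->.
rewrite negb_forall => /existsP[j]; rewrite negb_forall => /existsP[k].
rewrite negb_imply => /andP[/andP[/eqP gjk /eqP fjk] jk].
rewrite -det_tr (determinant_alternate jk) ?mulr0 ?mul0r ?dvdp0 // => i.
by rewrite !mxE /A fjk (gl _ _ gjk).
Qed.
End WronskianDivisibility.

(** * Wronskians of polynomials twisted by a power of 1 + x *)

Section WronskianOfFamily.
Context {R : realType}.
Implicit Types (b x : R) (t : bool * {poly R}) (l : seq (bool * {poly R})).

(* A pair [(true, p)] stands for [(1 + x) `^ (- b) * p] and [(false, p)] for [p]. *)
Definition twisted_poly b t : R -> R :=
  if t.1 then fun x => (1 + x) `^ (- b) * t.2.[x] else fun x => t.2.[x].

Definition twist b t : R := if t.1 then b else 0.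

(** The Wronskian matrix with the powers of [1 + x] removed from its rows and columns. *)
Definition euler_mx b l n : 'M[{poly R}]_n :=
  \matrix_(i < n, j < n)
    euler (twist b (nth (false, 0) l j)) (nth (false, 0) l j).2 i.

Lemma derive1n_twisted_poly b t i x : -1 < x ->
  ((twisted_poly b t)^`(i))%classic x
    = (1 + x) `^ (- twist b t - i%:R) * (euler (twist b t) t.2 i).[x].
Proof.
elim: i x => [|i IHi] x x1.
  rewrite /= subr0 /twisted_poly /twist; case: t.1 => //.
  by rewrite oppr0 powRr0 mul1r.
set c := twist b t in IHi *.
have x0 : 0 < 1 + x by lra.
set q := euler c t.2 i in IHi *.
(* The induction hypothesis holds only on [x > -1], so it is differentiated through equality near
   [x]. *)
have near_x : (\forall y \near x, (1 + y) `^ (- c - i%:R) * q.[y]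
    = ((twisted_poly b t)^`(i))%classic y)%classic.
  near=> y; rewrite IHi //; near: y.
  exact: lt_nbhsr.
have := @near_eq_is_derive R R R _ _ x 1 _ near_x.
set e := - c - i%:R.
have d1 : is_derive x 1 (fun y : R => 1 + y) 1.
  have := is_derive_poly ('X + 1) x; rewrite derivD derivX -polyC1 derivC addr0 hornerC.
  by rewrite (_ : horner _ = fun y => 1 + y) //; apply/funext => y; rewrite !hornerE addrC.
have dpow := is_derive1_comp (is_derive1_powR e x0) d1.
have := is_deriveM dpow (is_derive_poly q x).
set df := _ + _ => dfE /(_ df) /(_ dfE) [_ Df].
rewrite [LHS]/= derive1E Df /df /= -/q.
rewrite /= !(hornerD, hornerM, hornerN, hornerC, hornerX) -/q.
have -> : - c - i.+1%:R = e - 1 by rewrite /e -natr1; ring.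
have -> : (1 + x) `^ e = (1 + x) `^ (e - 1) * (1 + x).
  rewrite -[X in _ * X]powRr1 ?ltW // -powRD ?subrK //.
  by rewrite (gt_eqF x0) implybT.
rewrite /GRing.scale /= /e; ring.
Unshelve. all: by end_near. Qed.

(** Otherwise the naturals below [size (p - q)] would be too many roots of [p - q]. *)
Lemma poly_eq_gtN1 (p q : {poly R}) :
  (forall x, -1 < x -> p.[x] = q.[x]) -> p = q.
Proof.
move=> pq; apply/eqP; rewrite -subr_eq0; apply: contraT => r0.
have := max_poly_roots r0 (rs := [seq k%:R | k <- iota 0 (size (p - q))]).
rewrite size_map size_iota ltnn => -> //.
  apply/allP => _ /mapP[k _ ->]; rewrite /root !hornerE pq ?subrr //.
  by apply: lt_le_trans (ler0n _ k); rewrite oppr_lt0.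
by rewrite map_inj_uniq ?iota_uniq // => k k' /eqP; rewrite eqr_nat => /eqP.
Qed.

Lemma bin2D (m n : nat) : 'C(m + n, 2) = ('C(m, 2) + 'C(n, 2) + m * n)%N.
Proof. by elim: n => [|n IHn]; rewrite ?addn0 ?muln0 ?addnS ?binS ?bin1 ?IHn; lia. Qed.

(** Row [i] carries the exponent [-i], in total [- 'C(size l, 2)], and each twisted column carries
    [-b]. *)
Lemma wronskian_twisted b l x : -1 < x ->
  wronskian (map (twisted_poly b) l) x
  = (1 + x) `^ (- (b * (count fst l)%:R) - 'C(size l, 2)%:R)
    * (\det (euler_mx b l (size l))).[x].
Proof.
move=> x1; have x0 : 0 < 1 + x by lra.
rewrite /wronskian size_map; set n := size l.
have powD : {morph powR (1 + x) : r s / r + s >-> r * s}.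
  by move=> r s; rewrite powRD // (gt_eqF x0) implybT.
have pow_sum (I : Type) (s : seq I) (F : I -> R) :
    (1 + x) `^ (\sum_(i <- s) F i) = \prod_(i <- s) (1 + x) `^ F i.
  exact: (big_morph _ powD (powRr0 _)).
pose d1 : 'rV[R]_n := \row_i (1 + x) `^ (- i%:R).
pose d2 : 'rV[R]_n := \row_j (1 + x) `^ (- twist b (nth (false, 0) l j)).
rewrite (_ : \matrix_(i < n, j < n) _ =
    diag_mx d1 *m map_mx (horner_eval x) (euler_mx b l n) *m diag_mx d2); last first.
  apply/matrixP => i j; rewrite mul_mx_diag mul_diag_mx !mxE.
  rewrite (nth_map (false, 0)) // derive1n_twisted_poly // powD /horner_eval.
  by ring.
rewrite !det_mulmx !det_diag det_map_mx /horner_eval mulrAC; congr (_ * _).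
rewrite [LHS]mulrC powD; congr (_ * _).
  under eq_bigr => j _ do rewrite mxE.
  rewrite -pow_sum sumrN; congr (_ `^ (- _)).
  transitivity (\sum_(t <- l) twist b t).
    by rewrite [RHS](big_nth (false, 0)) big_mkord.
  elim: (l) => [|t l' IHl]; first by rewrite big_nil mulr0.
  by rewrite big_cons IHl natrD mulrDr; case: t => [[] p] /=; rewrite ?mulr1 ?mulr0.
under eq_bigr => j _ do rewrite mxE.
rewrite -pow_sum sumrN; congr (_ `^ (- _)).
by rewrite -natr_sum -bin2_sum big_mkord.
Qed.

Lemma dvdp_det_euler_mx b l :
  ('X + 1) ^+ ('C(count (fun t => ~~ t.1) l, 2) + 'C(count fst l, 2))
    %| \det (euler_mx b l (size l)).
Proof.
pose f (j : 'I_(size l)) := (twist b (nth (false, 0) l j), (nth (false, 0) l j).2).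
pose g (j : 'I_(size l)) := ~~ (nth (false, 0) l j).1.
have card_count (P : pred (bool * {poly R})) :
    #|[set j : 'I_(size l) | P (nth (false, 0) l j)]| = count P l.
  by rewrite -sum1_count (big_nth (false, 0)) big_mkord -sum1_card; apply: eq_bigl => j; rewrite inE.
have := @dvdp_det_euler R (size l) f g.
rewrite /g (card_count (fun t => ~~ t.1)).
rewrite (_ : [set j | ~~ ~~ _] = [set j : 'I_(size l) | (nth (false, 0) l j).1]); last first.
  by apply/setP => j; rewrite !inE negbK.
rewrite (card_count fst); apply => i j /negb_inj.
by rewrite /f /= /twist => ->.
Qed.

(** All exponents of [1 + x] cancel, because ['C(n1 + n2, 2) = 'C(n1, 2) + 'C(n2, 2) + n1 n2]. *)
Lemma poly_extending_wronskian b l (n1 n2 : nat) :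
  count (fun t => ~~ t.1) l = n1 -> count fst l = n2 ->
  poly_extending (fun x => (1 + x) `^ ((b + n1%:R) * n2%:R)
                           * wronskian (map (twisted_poly b) l) x)
    * ('X + 1) ^+ ('C(n1, 2) + 'C(n2, 2))
  = \det (euler_mx b l (size l)).
Proof.
move=> En1 En2; have := dvdp_det_euler_mx b l; rewrite En1 En2.
move=> /dvdpP[q Eq]; rewrite /poly_extending.
pose f x := (1 + x) `^ ((b + n1%:R) * n2%:R) * wronskian (map (twisted_poly b) l) x.
rewrite -/f.
have szl : size l = (n1 + n2)%N.
  by rewrite -En1 -En2 addnC count_predC.
have qP : forall x, -1 < x -> q.[x] = f x.
  move=> x x1; have x0 : 0 < 1 + x by lra.
  rewrite /f wronskian_twisted // Eq En2 mulrA -powRD; last first.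
    by rewrite (gt_eqF x0) implybT.
  rewrite hornerM horner_exp hornerD hornerX hornerC [x + 1]addrC. rewrite mulrCA -powR_mulrn; last exact: ltW.
  rewrite -powRD; last by rewrite (gt_eqF x0) implybT.
  rewrite [X in powR _ X](_ : _ = 0) ?powRr0 ?mulr1 //.
  by rewrite szl bin2D !natrD natrM; ring.
(* The quotient [q] witnesses existence, so [xget] does not return its default 0. *)
have /(xgetPex 0) : (exists p, [set p : {poly R} | forall x : R, -1 < x -> p.[x] = f x] p)%classic.
  by exists q.
move=> /= pP; rewrite Eq; congr (_ * _).
by apply: poly_eq_gtN1 => x x1; rewrite pP // qP.
Qed.

(** [bump i] skips row [i]: this is the minor left when one column is appended to [l] and then
    deleted along with row [i]. *)
Definition minor_mx b l (i : nat) : 'M[{poly R}]_(size l) :=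
  \matrix_(k < size l, j < size l)
    euler (twist b (nth (false, 0) l j)) (nth (false, 0) l j).2 (bump i k).

(** Laplace expansion along the untwisted last column; the cofactors do not involve [p]. *)
Lemma det_euler_mx_rcons b l p :
  \det (euler_mx b (rcons l (false, p)) (size l).+1)
  = \sum_(i < (size l).+1) ('X + 1) ^+ i * p^`(i)
      * ((-1) ^+ (i + size l) * \det (minor_mx b l i)).
Proof.
rewrite (expand_det_col _ ord_max); apply: eq_bigr => i _.
rewrite mxE nth_rcons ltnn eqxx /= -euler0E; congr (_ * _).
rewrite /cofactor; congr (_ * \det _); apply/matrixP => k j; rewrite !mxE.
by rewrite nth_rcons lift_max ltn_ord.
Qed.

Lemma minor_mx_size b l : minor_mx b l (size l) = euler_mx b l (size l).
Proof.
apply/matrixP => k j; rewrite !mxE /bump.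
by rewrite leqNgt ltn_ord.
Qed.
End WronskianOfFamily.

(** * Zeros near a simple zero of the leading coefficient *)

Section ZeroAttraction.
Context {R : realType}.
Local Notation C := R[i].
Implicit Types (z w : C) (p U : {poly C}) (a b B : R).

Lemma horner_bounded p B :
  exists2 M : R, 0 < M & forall z, normc z <= B -> normc p.[z] <= M.
Proof.
elim/poly_ind: p => [|p c [M M0 HM]].
  by exists 1 => // z _; rewrite horner0 normc0.
exists (M * `|B| + normc c + 1) => [|z zB].
  by rewrite ltr_wpDl // addr_ge0 ?normc_ge0 // mulr_ge0 // ltW.
rewrite hornerMXaddC; apply: le_trans (le_normcD _ _) _.
apply: le_trans (_ : M * `|B| + normc c <= _); last by rewrite lerDl.
rewrite lerD2r normcM ler_pM ?normc_ge0 ?HM //.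
exact: le_trans zB (ler_norm B).
Qed.

Lemma sum_horner_bounded (W : nat -> {poly C}) (r : nat) B :
  exists2 M : R, 0 < M &
    forall z, normc z <= B -> \sum_(i < r) normc (W i).[z] <= M.
Proof.
elim: r => [|r [M M0 HM]]; first by exists 1 => // z _; rewrite big_ord0.
have [M' M'0 HM'] := horner_bounded (W r) B.
exists (M + M') => [|z zB]; first exact: addr_gt0.
by rewrite big_ord_recr /= lerD ?HM ?HM'.
Qed.

Lemma horner_bounded_below p z0 : p.[z0] != 0 ->
  exists2 h : R, 0 < h & exists2 d : R, 0 < d &
    forall z, normc (z - z0) <= d -> h <= normc p.[z].
Proof.
move=> pz0; have /factor_theorem[q Eq] : root (p - p.[z0]%:P) z0.
  by rewrite /root !hornerE subrr.
have [M M0 HM] := horner_bounded q (normc z0 + 1).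
have p0 : 0 < normc p.[z0] by rewrite normc_gt0.
exists (normc p.[z0] / 2); first by rewrite divr_gt0.
(* Within this radius [p] changes by at most half of [normc p.[z0]]. *)
exists (Num.min 1 (normc p.[z0] / (2 * M))).
  by rewrite lt_min ltr01 divr_gt0 ?mulr_gt0.
move=> z; rewrite le_min => /andP[z1 zM].
have qz : normc q.[z] <= M.
  apply: HM; rewrite -{1}(subrK z0 z) addrC; apply: le_trans (le_normcD _ _) _.
  by rewrite lerD2l.
have E : p.[z0] = p.[z] - q.[z] * (z - z0).
  by have := congr1 (fun r => r.[z]) Eq; rewrite !hornerE => <-; ring.
have le1 : normc p.[z0] <= normc p.[z] + normc q.[z] * normc (z - z0).
  by rewrite {1}E -normcM -(normcN (_ * _)) le_normcD.
have le2 : normc q.[z] * normc (z - z0) <= normc p.[z0] / 2.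
  apply: le_trans (_ : M * (normc p.[z0] / (2 * M)) <= _).
    by apply: ler_pM; rewrite ?normc_ge0.
  by rewrite le_eqVlt; apply/orP; left; apply/eqP; field; rewrite gt_eqF.
lra.
Qed.

Lemma jacobi_combination_root a b (r : nat) z0 U (W : nat -> {poly C}) :
  -1 < a + r%:R -> -1 < b + r%:R -> z0 \notin `[-1, 1] -> U.[z0] != 0 ->
  exists2 c : R, 0 < c & exists n0 : nat, forall n, (n0 <= n)%N ->
    let P := cpoly (jacobi a b n) in
    let S := U * ('X - z0%:P) * P^`(r) + \sum_(i < r) W i * P^`(i) in
    S != 0 /\
    exists w, [/\ root S w, w \notin `[-1, 1] & normc (z0 - w) <= c / n%:R].
Proof.
move=> ha hb z0_far Uz0.
have [d0 d00 Hd0] := segment_dist z0_far.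
have [h h0 [d1 d10 HU]] := horner_bounded_below Uz0.
have [MW MW0 HW] := sum_horner_bounded W r (normc z0 + d0).
have dd : 0 < d0 / 2 by rewrite divr_gt0.
have [E [E0 [n1 HE]]] := jacobi_derivn_bound (normc z0 + d0) ha hb dd.
have [n2 Hroot] := jacobi_derivn_root ha hb.
pose C1 := MW * E; have C10 : 0 < C1 by rewrite mulr_gt0.
(* Relative to [P^(r)], the lower-order sum is at most [C1 / n] in the disc, while the main term is
   at least [h c / n = 3 C1 / n] on the circle of radius [c / n]. Hence [S] is at least [2 C1 / n]
   there but at most [C1 / n] at the centre. *)
pose c := 3 * C1 / h; have c0 : 0 < c by rewrite divr_gt0 ?mulr_gt0.
exists c => //; have [n3 Hn3] := exists_natr_ge (1 + c / d1 + c / (d0 / 2)).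
exists (maxn n1 (maxn n2 n3)) => n; rewrite !geq_max => /and3P[/HE {}HE].
move=> /Hroot {}Hroot /Hn3 {}Hn3 P S.
have cd1 : 0 < c / d1 by rewrite divr_gt0.
have cd0 : 0 < c / (d0 / 2) by rewrite divr_gt0.
have n0 : 0 < n%:R :> R by lra.
pose rho := c / n%:R; have rho0 : 0 < rho by rewrite divr_gt0.
have rho_d1 : rho <= d1.
  by rewrite ler_pdivrMr // mulrC -ler_pdivrMr //; lra.
have rho_d0 : rho <= d0 / 2.
  by rewrite ler_pdivrMr // mulrC -ler_pdivrMr //; lra.
have disc_far z : normc (z - z0) <= rho ->
    forall w, w \in `[-1, 1] -> d0 / 2 <= normc (z - w).
  move=> z_disc w /Hd0; have := le_normcD (z0 - z) (z - w).
  by rewrite addrA subrK normc_dist => le1 le2; lra.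
have disc_notin z : normc (z - z0) <= rho -> z \notin `[-1, 1].
  move=> /disc_far z_far; apply/negP => /z_far.
  by rewrite subrr normc0 leNgt dd.
have disc_Q z : normc (z - z0) <= rho -> 0 < normc P^`(r).[z].
  by move=> /disc_notin z_notin; rewrite normc_gt0; apply: contraNN z_notin; apply: Hroot.
have disc_sum z : normc (z - z0) <= rho ->
    normc (\sum_(i < r) W i * P^`(i)).[z] <= C1 / n%:R * normc P^`(r).[z].
  move=> z_disc; have zB : normc z <= normc z0 + d0.
    by have := le_normcD (z - z0) z0; rewrite subrK; lra.
  rewrite horner_sum.
  have le_sum (F : 'I_r -> C) : normc (\sum_i F i) <= \sum_i normc (F i).
    elim/big_ind2: _ => [|x1 x2 y1 y2 le1 le2|//]; first by rewrite normc0.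
    exact: le_trans (le_normcD _ _) (lerD le1 le2).
  apply: le_trans (le_sum _) _.
  apply: le_trans (_ : \sum_(i < r) normc (W i).[z] * (E / n%:R * normc P^`(r).[z]) <= _).
    apply: ler_sum => i _; rewrite hornerM normcM ler_wpM2l ?normc_ge0 //.
    by apply: HE => //; apply: disc_far.
  rewrite -mulr_suml /C1 -!mulrA; apply: ler_wpM2r; last exact: HW.
  by rewrite !mulr_ge0 ?invr_ge0 ?normc_ge0 // ltW.
have S_circle z : normc (z - z0) = rho ->
    2 * C1 / n%:R * normc P^`(r).[z] <= normc S.[z].
  move=> z_circle; have z_disc : normc (z - z0) <= rho by rewrite z_circle.
  rewrite /S hornerD -[X in _ + X]opprK; apply: le_trans (le_normc_sub _ _).
  rewrite normcN lerBrDr; apply: le_trans (lerD (lexx _) (disc_sum z z_disc)) _.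
  rewrite -mulrDl !hornerM hornerXsubC !normcM z_circle.
  apply: ler_wpM2r; first exact: normc_ge0.
  apply: le_trans (_ : h * rho <= _).
    by rewrite le_eqVlt; apply/orP; left; apply/eqP; rewrite /rho /c; field; rewrite !gt_eqF.
  by apply: ler_wpM2r; [exact: ltW|apply: HU; apply: le_trans z_disc _].
split.
  have Ez : normc (z0 + rho%:C - z0) = rho.
    by rewrite addrC addKr normc_real gtr0_norm.
  have := S_circle _ Ez; apply: contraTneq => ->; rewrite horner0 normc0 -ltNge.
  by rewrite !mulr_gt0 ?invr_gt0 // disc_Q // Ez.
have [[w [Sw w_disc]]|no_root] := pselect (exists w, root S w /\ normc (w - z0) <= rho).
  by exists w; split=> //; [exact: disc_notin|rewrite normc_dist].
(* With no root of [S] in the disc, the minimum modulus principle carries the circle bound to the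
   centre, a contradiction. *)
have : 2 * C1 / n%:R * normc P^`(r).[z0] <= normc S.[z0].
  apply: (minimum_modulus rho0); first by rewrite divr_gt0 ?mulr_gt0.
  - move=> z /Hroot z_seg; rewrite normc_dist; have := Hd0 z z_seg; lra.
  - by move=> z Sz; rewrite ltNge; apply/negP => z_disc; apply: no_root; exists z.
  - exact: S_circle.
have z0_disc : normc (z0 - z0) <= rho by rewrite subrr normc0 ltW.
rewrite /S hornerD !hornerM hornerXsubC subrr mulr0 mul0r add0r.
move=> le1; have le2 := disc_sum _ z0_disc; have Q0 := disc_Q _ z0_disc.
have : 0 < C1 / n%:R * normc P^`(r).[z0] by rewrite mulr_gt0 ?divr_gt0.
have : 2 * C1 / n%:R * normc P^`(r).[z0] = 2 * (C1 / n%:R * normc P^`(r).[z0]) by rewrite !mulrA.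
by lra.
Qed.

End ZeroAttraction.

(** * Exceptional Jacobi polynomials *)

Section ExceptionalJacobi.
Context {R : realType}.
Local Notation C := R[i].
Implicit Types (a b : R) (lam mu : seq nat).

Definition jacobi_pairs a b lam mu : seq (bool * {poly R}) :=
  [seq (false, jacobi a b n) | n <- assoc_seq lam]
  ++ [seq (true, jacobi a (- b) m) | m <- assoc_seq mu].

Lemma jacobi_familyE a b lam mu :
  jacobi_family a b lam mu = map (twisted_poly b) (jacobi_pairs a b lam mu).
Proof. by rewrite /jacobi_family /jacobi_pairs map_cat -!map_comp. Qed.

Lemma count_jacobi_pairs a b lam mu :
  count fst (jacobi_pairs a b lam mu) = size mu /\
  count (fun t => ~~ t.1) (jacobi_pairs a b lam mu) = size lam.
Proof.
have E v (f : nat -> {poly R}) (A : seq nat) :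
    count fst [seq (v, f n) | n <- A] = (v * size A)%N /\
    count (fun t => ~~ t.1) [seq (v, f n) | n <- A] = (~~ v * size A)%N.
  by elim: A => [|k A [/= -> ->]]; rewrite ?muln0 ?mulnS.
rewrite /jacobi_pairs !count_cat.
have [-> ->] := E false (jacobi a b) (assoc_seq lam).
have [-> ->] := E true (jacobi a (- b)) (assoc_seq mu).
by rewrite /= !mul0n !mul1n !size_mkseq addn0.
Qed.

Lemma size_jacobi_pairs a b lam mu :
  size (jacobi_pairs a b lam mu) = (size lam + size mu)%N.
Proof. by rewrite size_cat !size_map !size_iota. Qed.

Lemma gen_jacobiE a b lam mu (l := jacobi_pairs a b lam mu) :
  gen_jacobi a b lam mu * ('X + 1) ^+ ('C(size lam, 2) + 'C(size mu, 2))
    = \det (euler_mx b l (size l)).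
Proof.
have [cnt1 cnt0] := count_jacobi_pairs a b lam mu.
by rewrite /gen_jacobi jacobi_familyE (poly_extending_wronskian b cnt0 cnt1).
Qed.

Lemma exc_jacobiE a b lam mu n (l := jacobi_pairs a b lam mu)
    (s := (n + size lam - (sumn lam + sumn mu))%N) :
  exc_jacobi a b lam mu n * ('X + 1) ^+ ('C((size lam).+1, 2) + 'C(size mu, 2))
    = \det (euler_mx b (rcons l (false, jacobi a b s)) (size l).+1).
Proof.
have [cnt1 cnt0] := count_jacobi_pairs a b lam mu.
rewrite -(size_rcons l (false, jacobi a b s)).
rewrite -(@poly_extending_wronskian _ b _ (size lam).+1 (size mu)).
- congr (poly_extending _ * _); apply/funext => x.
  by rewrite map_rcons -jacobi_familyE -addrA natr1.
- by rewrite -cats1 count_cat /= cnt0 addn0 addn1.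
- by rewrite -cats1 count_cat /= cnt1 !addn0.
Qed.

Lemma cpolyM (p q : {poly R}) : cpoly (p * q) = cpoly p * cpoly q.
Proof. exact: rmorphM. Qed.

Lemma cpolyD (p q : {poly R}) : cpoly (p + q) = cpoly p + cpoly q.
Proof. exact: rmorphD. Qed.

Lemma cpoly_sum (n : nat) (F : 'I_n -> {poly R}) :
  cpoly (\sum_i F i) = \sum_i cpoly (F i).
Proof. exact: rmorph_sum. Qed.

Lemma cpolyX1 n : cpoly (('X + 1 : {poly R}) ^+ n) = ('X + 1) ^+ n.
Proof. by rewrite /cpoly rmorphXn rmorphD rmorph1 /= map_polyX. Qed.

Lemma cpoly_exc_jacobi a b lam mu : exists W : nat -> {poly C},
  forall n (s := (n + size lam - (sumn lam + sumn mu))%N)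
         (r := (size lam + size mu)%N) (P := cpoly (jacobi a b s)),
    cpoly (exc_jacobi a b lam mu n)
      * ('X + 1) ^+ ('C((size lam).+1, 2) + 'C(size mu, 2))
    = cpoly (gen_jacobi a b lam mu)
        * ('X + 1) ^+ ('C(size lam, 2) + 'C(size mu, 2) + r) * P^`(r)
      + \sum_(i < r) W i * P^`(i).
Proof.
set l := jacobi_pairs a b lam mu.
exists (fun i => ('X + 1) ^+ i
  * cpoly ((-1) ^+ (i + size l) * \det (minor_mx b l i))) => n s r P.
have -> : r = size l by rewrite size_jacobi_pairs.
have := congr1 (@cpoly R) (exc_jacobiE a b lam mu n).
rewrite -/l -/s cpolyM cpolyX1 => ->.
(* The top term has sign [+1], and its minor is the full matrix of [l], that is, the generalized
   Jacobi polynomial times a power of ['X + 1]. *)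
rewrite det_euler_mx_rcons big_ord_recr /= addnn -signr_odd odd_double mul1r.
rewrite minor_mx_size /l -gen_jacobiE -/l.
rewrite cpolyD cpoly_sum addrC; congr (_ + _).
  by rewrite !cpolyM !cpolyX1 -cpoly_derivn -/P !exprD; ring.
apply: eq_bigr => i _; by rewrite 2!cpolyM cpolyX1 -cpoly_derivn -/P; ring.
Qed.

Lemma simple_root_factor (p : {poly C}) z : mup z p = 1%N ->
  exists2 q : {poly C}, p = q * ('X - z%:P) & q.[z] != 0.
Proof.
move=> mup1; have [p0|p0] := eqVneq p 0.
  (* For the zero polynomial only the index 0 is available, so [mup] is 0 rather than 1. *)
  move: mup1; rewrite p0 /mup; case: arg_maxnP; first by rewrite expr0 dvd1p.
  by case=> [[|i]] /=; rewrite size_poly0.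
have : ('X - z%:P) ^+ 1 %| p by rewrite -mup_geq ?mup1.
rewrite expr1 => /dvdpP[q Eq]; exists q => //.
apply/negP => /factor_theorem[q' Eq'].
have : ('X - z%:P) ^+ 2 %| p by rewrite Eq Eq' -mulrA dvdp_mulIr.
by rewrite -mup_geq // mup1.
Qed.

Lemma mem_czeros (p : {poly R}) (w : C) :
  p != 0 -> root (cpoly p) w -> w \in czeros p.
Proof.
rewrite -(map_poly_eq0 (real_complex R)) -/(cpoly p) -lead_coef_eq0 /czeros.
case: closed_field_poly_normal => s /= {2}-> p0.
by rewrite rootZ // root_prod_XsubC.
Qed.
End ExceptionalJacobi.

Theorem theorem6p6 (R : realType) (lam mu : seq nat)
    (hlam : is_intpart lam) (hmu : is_intpart mu) (a b : R)
    (hab : forall n k : nat, n \in assoc_seq lam -> (1 <= k <= n)%N ->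
       a + b + n%:R != - k%:R)
    (hab' : forall m k : nat, m \in assoc_seq mu -> (1 <= k <= m)%N ->
       a - b + m%:R != - k%:R)
    (hb : forall n m : nat, n \in assoc_seq lam -> m \in assoc_seq mu ->
       b != m%:R - n%:R)
    (ha1 : -1 < a + (size lam + size mu)%:R)
    (hb1 : -1 < b + (size lam + size mu)%:R)
    (zs : R[i]) (hzs : zs \notin `[-1, 1])
    (hsimple : mup zs (cpoly (gen_jacobi a b lam mu)) = 1%N) :
  exists c : R, 0 < c /\
    exists n0 : nat, forall n : nat, (n0 <= n)%N -> degree_seq lam mu n ->
      (\big[mine/+oo]_(z <- exc_zeros a b lam mu n)
         (ComplexField.Normc.normc (zs - z))%:E < (c / n%:R)%:E)%E.
Proof.
have [G EG Gz] := simple_root_factor hsimple.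
have [W EW] := cpoly_exc_jacobi a b lam mu.
set r := (size lam + size mu)%N in ha1 hb1 EW.
set m := ('C(size lam, 2) + 'C(size mu, 2) + r)%N in EW.
pose U := G * ('X + 1) ^+ m.
have N1_seg : (-1 : R[i]) \in `[-1, 1].
  by rewrite in_itv /= lexx -subr_ge0 opprK addr_ge0.
have Uz : U.[zs] != 0.
  rewrite /U hornerM horner_exp mulf_neq0 // expf_neq0 // !hornerE.
  by apply: contraNneq hzs => /eqP; rewrite addr_eq0 => /eqP->.
have [c c0 [n0 Hc]] := jacobi_combination_root W ha1 hb1 hzs Uz.
(* The zero lies within [c / s] and [n <= 2 s], so the distance is at most [2 c / n]; 3 makes the
   inequality strict. *)
exists (3 * c); split; first by rewrite mulr_gt0.
exists (n0 + 2 * (sumn lam + sumn mu) + 1)%N => n le_n _.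
set s := (n + size lam - (sumn lam + sumn mu))%N.
have [n0s n_gt0 ns] : [/\ n0 <= s, 0 < n & n <= 2 * s]%N.
  by move: le_n; rewrite /s; clear; split; lia.
have [S0 [w [Sw w_seg w_near]]] := Hc s n0s.
have ES := EW n; rewrite -/s EG in ES.
set S := _ + _ in S0 Sw.
have {}ES : cpoly (exc_jacobi a b lam mu n)
    * ('X + 1) ^+ ('C((size lam).+1, 2) + 'C(size mu, 2)) = S.
  by rewrite ES /S /U; congr (_ + _); ring.
(* Since [w] is not [-1], its vanishing comes from the exceptional polynomial and not from the power
   of ['X + 1]. *)
have wN1 : w + 1 != 0.
  by apply: contraNneq w_seg => /eqP; rewrite addr_eq0 => /eqP->.
have exc_w : root (cpoly (exc_jacobi a b lam mu n)) w.
  move: Sw; rewrite -ES rootM => /orP[//|].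
  by rewrite /root horner_exp !hornerE expf_eq0 (negPf wN1) andbF.
have exc0 : exc_jacobi a b lam mu n != 0.
  by apply: contraNneq S0 => exc0; rewrite -ES exc0 /cpoly rmorph0 mul0r.
have w_exc : w \in exc_zeros a b lam mu n.
  rewrite mem_filter mem_czeros // andbT; apply: contraNN w_seg.
  by rewrite !in_itv /= => /andP[/ltW-> /ltW->].
rewrite (big_rem w) //= gt_min; apply/orP; left.
rewrite lte_fin; apply: le_lt_trans w_near _.
have {}n_gt0 : 0 < n%:R :> R by rewrite ltr0n.
have {}ns : n%:R <= 2 * s%:R :> R by rewrite -natrM ler_nat.
have s_gt0 : 0 < s%:R :> R by lra.
rewrite ltr_pdivrMr // mulrAC ltr_pdivlMr // [3 * c]mulrC -mulrA ltr_pM2l //.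
lra.
Qed.
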